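(* Let $c>0$, $k>0$, $s=1$, $U_0(\xi)=3c\,\mathrm{sech}^2\left(\frac{\sqrt c}{2}\xi\right)$, $\Omega_c=-\frac{c}{16}(\sqrt{1+48k}-1)^2$, $g(\xi)=\mathrm{sech}^p\left(\frac{\sqrt c}{2}\xi\right)$ with $p=\frac{\sqrt{1+48k}-1}{2}$, and $L_1=-\partial_\xi^2+c-U_0$. Let $(U,A)$ be the profile of the branch bifurcating from $(U_0,0)$ at $\Omega=\Omega_c$ (described in the context), for $\Omega\ne\Omega_c$ sufficiently close to $\Omega_c$. If either $\langle g^2,L_1^{-1}g^2\rangle<0$ or $\langle g^2,L_1^{-1}g^2\rangle>0$, then $(U,A)$ is a local minimizer of the constrained energy $H$ for fixed momentum $P$ and mass $Q$, degenerate only by the translational and rotational symmetries; that is, the constrained Hessian $\widehat{\mathcal L}$ has no negative eigenvalues and $\ker\widehat{\mathcal L}=\mathrm{span}\{(U',A',0),(0,0,A)\}$.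
   Context: $L_1^{-1}$ is the bounded inverse of $L_1$ on the even functions in $L^2(\mathbb{R})$ ($\ker L_1$ is spanned by the odd function $U_0'$); $\langle\cdot,\cdot\rangle$ is the $L^2(\mathbb{R})$ inner product. Bifurcating branch (when $\langle g^2,L_1^{-1}g^2\rangle\neq0$): for $\Omega<0$ near $\Omega_c$ with $\mathrm{sgn}(\Omega-\Omega_c)=-\mathrm{sgn}(\langle g^2,L_1^{-1}g^2\rangle)$, there is a solution $(U,A)\in H^2(\mathbb{R})\times H^2(\mathbb{R})$ of $$U''-cU+\tfrac12U^2+sA^2=0,\qquad A''+(\Omega+kU)A=0$$ with $U$, $A$ even, $A\neq0$, $\|U-U_0\|_{H^2}\le C|\Omega-\Omega_c|$ and $\|A\|_{H^2}\le C\sqrt{|\Omega-\Omega_c|}$ with $C$ independent of $\Omega$; it is unique up to $A\mapsto-A$. Such profiles are critical points of the action $H(U,A)+cP(U,0)-\Omega Q(A)$, with $$H(U,A)=\tfrac12\int\left((U')^2-\tfrac13U^3+\tfrac{2s}{k}(A')^2-2sUA^2\right)d\xi,\quad P(U,0)=\tfrac12\int U^2d\xi,\quad Q(A)=\tfrac sk\int A^2d\xi .$$ For perturbations $w$ of $U$ and $z_1+iz_2$ of $A$ (real $w,z_1,z_2$), the Hessian of the action is the operator in $(L^2(\mathbb{R}))^3$ with domain $(H^2(\mathbb{R}))^3$ $$\mathcal{L}=\begin{pmatrix}-\partial_\xi^2+c-U&-2sA&0\\-2sA&\frac{2s}{k}(-\partial_\xi^2-\Omega-kU)&0\\0&0&\frac{2s}{k}(-\partial_\xi^2-\Omega-kU)\end{pmatrix},$$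 and $\widehat{\mathcal L}$ is the compression of $\mathcal L$ (by orthogonal projection) to the subspace of $(w,z_1,z_2)\in(L^2(\mathbb{R}))^3$ with $\langle U,w\rangle=0$ and $\langle A,z_1\rangle=0$. *)

(* Defs.v *)
(* MathComp-Analysis. *)
From HB Require Import structures.
From mathcomp Require Import all_boot all_order all_algebra.
From mathcomp Require Import all_classical all_reals all_analysis.

Set Implicit Arguments.
Unset Strict Implicit.
Unset Printing Implicit Defensive.

Import Order.TTheory GRing.Theory Num.Theory.
Import numFieldNormedType.Exports.

Local Open Scope classical_set_scope.
Local Open Scope ring_scope.

Section Sobolev.
Context {R : realType}.
Local Notation mu := (@lebesgue_measure R).
Implicit Types f g h : R -> R.

Definition Lsq : set (R -> R) := [set f | f \in Lfun mu 2%:E].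

Definition inner f g : R := \int[mu]_x (f x * g x).

(* Sobolev functions are handled through their continuous representatives:
   f is in H^1 iff f is in L^2 and is the integral of some g in L^2, and then
   g, which is unique up to a null set, is the weak derivative of f. *)
Definition is_wderiv f g : Prop :=
  Lsq g /\ forall a b : R, a <= b -> f b - f a = \int[mu]_(x in `[a, b]) g x.

Definition H1 : set (R -> R) := [set f | Lsq f /\ exists g, is_wderiv f g].

Definition wderiv f : R -> R := xget (cst 0) [set g | is_wderiv f g].

(* The continuous representative of an H^2 function is of class C^1, so its
   first derivative is the classical one; only the second one is weak. *)
Definition H2 : set (R -> R) :=
  [set f | [/\ Lsq f, (forall x, derivable f x 1) & H1 (derive1 f)]].

Definition D2 f : R -> R := wderiv (derive1 f).

Definition normH2 f : R :=
  Num.sqrt (inner f f + inner (derive1 f) (derive1 f) + inner (D2 f) (D2 f)).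

Definition even_fun f : Prop := forall x, f (- x) = f x.

End Sobolev.

Section Soliton.
Context {R : realType}.
Local Notation mu := (@lebesgue_measure R).
Variables c k : R.

Definition sech (x : R) : R := 2 / (expR x + expR (- x)).

Definition U0 (x : R) : R := 3 * c * sech (Num.sqrt c / 2 * x) ^+ 2.

Definition Omega_c : R := - (c / 16) * (Num.sqrt (1 + 48 * k) - 1) ^+ 2.

Definition p_exp : R := (Num.sqrt (1 + 48 * k) - 1) / 2.

Definition gmode (x : R) : R := sech (Num.sqrt c / 2 * x) `^ p_exp.

Definition L1op (f : R -> R) (x : R) : R := - D2 f x + (c - U0 x) * f x.

(* As ker L1 is spanned by the odd function U0', L1 has at most one even
   preimage of f in H^2. *)
Definition L1inv (f : R -> R) : R -> R :=
  xget (cst 0)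
    [set h | [/\ H2 h, even_fun h & {ae mu, forall x, L1op h x = f x}]].

Definition bif_coef : R :=
  let g2 := fun x => gmode x ^+ 2 in inner g2 (L1inv g2).

(* (U, A) is a point, at the parameter Om, of the branch bifurcating from
   (U0, 0) at Omega_c, with constant C in the estimates. *)
Definition branch_profile (s C Om : R) (U A : R -> R) : Prop :=
  [/\ Om < 0 /\ Num.sg (Om - Omega_c) = - Num.sg bif_coef,
      [/\ H2 U, H2 A, even_fun U, even_fun A & A <> cst 0],
      {ae mu, forall x, D2 U x - c * U x + U x ^+ 2 / 2 + s * A x ^+ 2 = 0},
      {ae mu, forall x, D2 A x + (Om + k * U x) * A x = 0} &
      normH2 (U - U0) <= C * `|Om - Omega_c| /\
      normH2 A <= C * Num.sqrt `|Om - Omega_c|].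

End Soliton.

Section ConstrainedHessian.
Context {R : realType}.

(* triples (w, z1, z2) of real functions *)
Definition triple : Type := ((R -> R) * (R -> R) * (R -> R))%type.

Definition inner3 (u v : triple) : R :=
  inner u.1.1 v.1.1 + inner u.1.2 v.1.2 + inner u.2 v.2.

Variables (c k s Om : R) (U A : R -> R).

Definition hessian (v : triple) : triple :=
  let: (w, z1, z2) := v in
  let Lz (z : R -> R) x := 2 * s / k * (- D2 z x - Om * z x - k * U x * z x) in
  (fun x => - D2 w x + (c - U x) * w x - 2 * s * A x * z1 x,
   fun x => - 2 * s * A x * w x + Lz z1 x,
   fun x => Lz z2 x).

Definition constraint_space : set triple :=
  [set v | [/\ Lsq v.1.1, Lsq v.1.2, Lsq v.2,
               inner U v.1.1 = 0 & inner A v.1.2 = 0]].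

Definition orth_proj (X : set triple) (u v : triple) : Prop :=
  X v /\ forall x, X x -> inner3 (u - v) x = 0.

(* Graph of the compression: chessian v f means that v is in its domain, the
   H^2 triples satisfying the constraints, and that it maps v to (the L^2
   class of) f. *)
Definition chessian (v f : triple) : Prop :=
  [/\ H2 v.1.1, H2 v.1.2, H2 v.2, constraint_space v &
      orth_proj constraint_space (hessian v) f].

Definition chessian_eigenvalue (lam : R) : Prop :=
  exists2 v : triple, v <> (cst 0, cst 0, cst 0) &
    chessian v (lam *: v.1.1, lam *: v.1.2, lam *: v.2).

Definition chessian_ker : set triple :=
  [set v | chessian v (cst 0, cst 0, cst 0)].

(* span {(U', A', 0), (0, 0, A)} *)
Definition symmetry_span : set triple :=
  [set v | exists a b : R, v = (a *: derive1 U, a *: derive1 A, b *: A)].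

End ConstrainedHessian.

(* Main.v *)
(* At the bifurcation point (U0, 0) the Hessian is block diagonal, with blocks
   L_1 = -d^2 + c - U0 and, twice, (2/k) L_g with L_g = -d^2 - Omega_c - k U0 >= 0,
   ker L_g = span g.  The constraint <U, w> = 0 removes the only negative
   direction of L_1, and <A, z1> = 0 removes g from the z1 component because
   A / |A| is close to g / |g|: so the constrained form is coercive at (U0, 0)
   modulo (U0', 0, 0) and (0, 0, g).  Coercivity persists near the bifurcation
   point modulo (U', A', 0) and (0, 0, A), which are exact kernel vectors of
   the Hessian at (U, A); hence there is no other kernel vector and no negative
   eigenvalue.

   Both spectral gaps come from the factorization of Poeschl-Teller operators
   by the ladder operators B_p = d + p th tanh(th x), th = sqrt c / 2, whose
   kernel is spanned by sech^p: B_p B_p^* = B_{p-1}^* B_{p-1} + (2p - 1) th^2. *)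
Require Import Defs.
From mathcomp Require Import all_boot all_order all_algebra.
From mathcomp Require Import all_classical all_reals all_analysis.
From mathcomp Require Import measurable_realfun ring lra.
Import Order.TTheory GRing.Theory Num.Theory.
Import numFieldNormedType.Exports.
Local Open Scope classical_set_scope.
Local Open Scope ring_scope.
Set Implicit Arguments.
Unset Strict Implicit.
Unset Printing Implicit Defensive.

(** * Square-integrable functions *)

Section SquareIntegrable.
Context {R : realType}.
Local Notation mu := (@lebesgue_measure R).
Implicit Types (f g h : R -> R) (a b M : R).

(** The argument works with quadratic forms, without spectral theory. If the compressed Hessian maps
    v to lam v with lam <= 0, then H v = lam v + (m U, n A, 0) with multipliers m, n. Subtract a
    symmetry vector a (U', A', 0) + b (0, 0, A) and test with the remainder r. The multipliers
    vanish because r satisfies the constraints; lam times the product of v with the symmetry vector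
    vanishes because H is symmetric. So the form at r is lam |v|^2 <= 0, coercivity gives r = 0 and
    lam |v|^2 = 0, and this settles negative eigenvalues and kernel at once.

    Three obstacles shape the estimates. The constraints involve U and A, not U0 and g, so each gap
    must survive a tilt of its orthogonality condition. A tends to 0 along the branch, so its
    closeness to g is measured relative to |A|, through the equation of A. And k > 0 is arbitrary,
    so 2 p - 1 may be negative: p < 1 needs its own estimate.

    Second derivatives are weak by definition; the equations make them continuous, so computations
    use classical derivatives. *)

Lemma ae_sub (P Q : R -> Prop) : (forall x, P x -> Q x) ->
  {ae mu, forall x, P x} -> {ae mu, forall x, Q x}.
Proof.
move=> PQ [N [mN N0 sub]]; exists N; split => //.
by move=> x /= nQ; apply: sub => /= /PQ.
Qed.

Lemma Lsq_measurable f : Lsq f -> measurable_fun setT f.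
Proof. by rewrite /Lsq /= => /sub_Lfun_mfun /set_mem. Qed.

Lemma LsqP f : Lsq f <->
  measurable_fun setT f /\ mu.-integrable setT (EFin \o (fun x => f x ^+ 2)).
Proof.
split=> [Lf|[mf intf]].
  by split; [exact: Lsq_measurable|exact: Lfun2_integrable_sqr].
rewrite /Lsq /=; apply/andP; split; rewrite inE //=.
rewrite /finite_norm unlock /= poweR_lty//.
move/integrableP : intf => [_]; apply: le_lt_trans.
apply: ge0_le_integral => //.
- apply/measurable_EFinP.
  apply/(@measurableT_comp _ _ _ _ _ _ (fun x : R => x `^ 2)%R) => //.
  exact/measurableT_comp.
- apply: measurableT_comp => //; apply/measurable_EFinP; exact: measurable_funX.
- by move=> x _ /=; rewrite lee_fin normrX powR_mulrn.
Qed.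

Lemma Lsq_comb a f g : Lsq f -> Lsq g -> Lsq (a *: f + g).
Proof.
have [_ h] := Lfun_submod_closed mu (lee1n 2 : (1 <= 2%:E :> \bar R)%E).
by rewrite /Lsq /=; exact: h.
Qed.

Lemma Lsq0 : Lsq (0 : R -> R).
Proof.
by case: (Lfun_submod_closed mu (lee1n 2 : (1 <= 2%:E :> \bar R)%E)).
Qed.

Lemma LsqD f g : Lsq f -> Lsq g -> Lsq (f + g).
Proof. by rewrite -{2}[f]scale1r; exact: Lsq_comb. Qed.

Lemma LsqZ a f : Lsq f -> Lsq (a *: f).
Proof. by move=> Lf; rewrite -[a *: f]addr0; exact: Lsq_comb Lsq0. Qed.

Lemma LsqN f : Lsq f -> Lsq (- f).
Proof. by rewrite -scaleN1r; exact: LsqZ. Qed.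

Lemma LsqB f g : Lsq f -> Lsq g -> Lsq (f - g).
Proof. by move=> Lf Lg; apply: LsqD => //; exact: LsqN. Qed.

Lemma Lsq_dom f g M : measurable_fun setT f -> (forall x, `|f x| <= M * `|g x|) ->
  Lsq g -> Lsq f.
Proof.
move=> mf fg /LsqP[mg ig]; apply/LsqP; split=> //.
apply: (le_integrable measurableT _ _ (integrableZl measurableT (M ^+ 2) ig)).
  by apply/measurable_EFinP; exact: measurable_funX.
move=> x _ /=; rewrite lee_fin (@ger0_norm _ (f x ^+ 2)) ?sqr_ge0//.
rewrite -exprMn [leRHS]ger0_norm ?sqr_ge0//.
rewrite -(@real_normK _ (f x)) ?num_real// -[leRHS]real_normK ?num_real//.
rewrite lerXn2r ?nnegrE// (le_trans (fg x))// normrM ler_wpM2r//.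
exact: ler_norm.
Qed.

Lemma LsqM f g M : measurable_fun setT f -> (forall x, `|f x| <= M) ->
  Lsq g -> Lsq (f * g).
Proof.
move=> mf fM Lg; apply: (@Lsq_dom _ g M) => //.
  by apply: measurable_funM => //; exact: Lsq_measurable.
by move=> x; rewrite normrM ler_wpM2r.
Qed.

Lemma Lsq_ae f g : measurable_fun setT f -> {ae mu, forall x, f x = g x} ->
  Lsq g -> Lsq f.
Proof.
move=> mf fg /LsqP[mg ig]; apply/LsqP; split=> //.
move/integrableP : ig => [mg2 ig]; apply/integrableP; split.
  by apply/measurable_EFinP; exact: measurable_funX.
apply: le_lt_trans ig; apply: ae_ge0_le_integral => //.
- by apply: measurableT_comp => //; apply/measurable_EFinP; exact: measurable_funX.
- exact: measurableT_comp.
- by apply: ae_sub fg => x /= ->.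
Qed.

Lemma Lsq_integrableM f g : Lsq f -> Lsq g ->
  mu.-integrable setT (EFin \o (f * g)).
Proof. by move=> Lf Lg; apply/Lfun1_integrable; exact: Lfun2_mul_Lfun1. Qed.

Lemma innerC f g : inner f g = inner g f.
Proof. by congr Rintegral; apply/funext => x; rewrite mulrC. Qed.

Lemma inner_mull f g h : inner (f * g) h = inner g (f * h).
Proof. by congr Rintegral; apply/funext => x /=; rewrite mulrCA mulrA. Qed.

Lemma innerDl f g h : Lsq f -> Lsq g -> Lsq h ->
  inner (f + g) h = inner f h + inner g h.
Proof.
move=> Lf Lg Lh; rewrite -RintegralD//; [|exact: Lsq_integrableM..].
by congr Rintegral; apply/funext => x; rewrite mulrDl.
Qed.

Lemma innerZl a f g : Lsq f -> Lsq g -> inner (a *: f) g = a * inner f g.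
Proof.
move=> Lf Lg; rewrite -RintegralZl//; last exact: Lsq_integrableM.
by congr Rintegral; apply/funext => x; rewrite mulrA.
Qed.

Lemma innerNl f g : Lsq f -> Lsq g -> inner (- f) g = - inner f g.
Proof. by move=> Lf Lg; rewrite -scaleN1r innerZl// mulN1r. Qed.

Lemma innerDr f g h : Lsq f -> Lsq g -> Lsq h ->
  inner f (g + h) = inner f g + inner f h.
Proof. by move=> *; rewrite innerC innerDl// ![inner _ f]innerC. Qed.

Lemma innerZr a f g : Lsq f -> Lsq g -> inner f (a *: g) = a * inner f g.
Proof. by move=> *; rewrite innerC innerZl// [inner _ f]innerC. Qed.

Lemma innerNr f g : Lsq f -> Lsq g -> inner f (- g) = - inner f g.
Proof. by move=> *; rewrite innerC innerNl// [inner _ f]innerC. Qed.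

Lemma inner0l f : inner 0 f = 0.
Proof.
by rewrite /inner; under eq_Rintegral do rewrite mul0r; rewrite Rintegral_cst// mul0r.
Qed.

Lemma inner_ge0 f : 0 <= inner f f.
Proof. by apply: Rintegral_ge0 => x _; rewrite -expr2 sqr_ge0. Qed.

Lemma inner_le f1 g1 f2 g2 : Lsq f1 -> Lsq g1 -> Lsq f2 -> Lsq g2 ->
  (forall x, f1 x * g1 x <= f2 x * g2 x) -> inner f1 g1 <= inner f2 g2.
Proof. by move=> *; apply: le_Rintegral => //; exact: Lsq_integrableM. Qed.

Lemma inner_ae f g h : measurable_fun setT f -> measurable_fun setT g ->
  measurable_fun setT h -> {ae mu, forall x, f x = g x} -> inner f h = inner g h.
Proof.
move=> mf mg mh fg; congr fine; apply: ae_eq_integral => //.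
- by apply/measurable_EFinP; exact: measurable_funM.
- by apply/measurable_EFinP; exact: measurable_funM.
- by apply: ae_sub fg => x /= ->.
Qed.

Lemma inner_eq0_ae f : Lsq f -> inner f f = 0 -> {ae mu, forall x, f x = 0}.
Proof.
move=> Lf f0; have If := Lsq_integrableM Lf Lf.
have /(ae_eq_integral_abs mu measurableT (measurable_int _ If)) :
    (\int[mu]_x `|(EFin \o (f * f)%R) x| = 0)%E.
  transitivity (inner f f)%:E; last by rewrite f0.
  rewrite /inner /Rintegral fineK; last exact: integrable_fin_num.
  apply: eq_integral => x _ /=.
  by congr EFin; rewrite ger0_norm// -[(f * f) x]expr2 sqr_ge0.
apply: ae_sub => x /(_ I) /= [] /eqP.
by rewrite mulf_eq0 orbb => /eqP.
Qed.

Lemma continuous_ae0 f : continuous f -> {ae mu, forall x, f x = 0} ->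
  f = 0.
Proof.
move=> cf f0; apply/funext => x0; apply/eqP/negP => /negP fx0.
have [e /= e0 He] : \forall y \near x0, f y != 0.
  exact: (cvgr_neq0 _ (cf x0)).
case: f0 => N [mN N0 sub].
have sub2 : `]x0 - e, x0 + e[ `<=` N.
  move=> y; rewrite /= in_itv /= => /andP[y1 y2]; apply: sub => /= fy.
  have : f y != 0.
    by apply: He; rewrite /ball /= ltr_distl; apply/andP; split; lra.
  by rewrite fy eqxx.
have : (mu `](x0 - e)%R, (x0 + e)%R[ <= mu N)%E.
  by apply: le_measure => //; rewrite inE /=; first exact: measurable_itv.
rewrite N0 lebesgue_measure_itv /= lte_fin ifT; last lra.
rewrite -EFinB lee_fin; lra.
Qed.

Lemma inner_eq0 f : continuous f -> Lsq f -> inner f f = 0 -> f = 0.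
Proof. by move=> cf Lf f0; apply: continuous_ae0 => //; exact: inner_eq0_ae. Qed.

Lemma inner_CS f g : Lsq f -> Lsq g -> inner f g ^+ 2 <= inner f f * inner g g.
Proof.
move=> Lf Lg.
have key t : 0 <= inner f f + 2 * t * inner f g + t ^+ 2 * inner g g.
  have := inner_ge0 (f + t *: g).
  have LZ := LsqZ t Lg; have LD := LsqD Lf LZ.
  rewrite innerDl// !innerDr// !innerZl// ?innerZr// [inner g f]innerC.
  by congr (_ <= _); ring.
have [g0|g0] := eqVneq (inner g g) 0.
  rewrite g0 mulr0; suff -> : inner f g = 0 by rewrite expr0n.
  apply/eqP/negP => /negP fg0.
  (* With [inner g g = 0] the expression is affine in t; at this t it equals -1. *)
  have := key (- (inner f f + 1) / (2 * inner f g)).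
  rewrite g0 mulr0 addr0.
  have -> : 2 * (- (inner f f + 1) / (2 * inner f g)) * inner f g = - (inner f f + 1).
    by field; exact: fg0.
  lra.
have gp : 0 < inner g g by rewrite lt_neqAle eq_sym g0 inner_ge0.
have := key (- inner f g / inner g g).
have -> : inner f f + 2 * (- inner f g / inner g g) * inner f g
   + (- inner f g / inner g g) ^+ 2 * inner g g
   = (inner f f * inner g g - inner f g ^+ 2) / inner g g.
  by field; exact: g0.
by rewrite pmulr_lge0 ?invr_gt0// subr_ge0.
Qed.

End SquareIntegrable.

Create HintDb lsq.
#[global] Hint Resolve Lsq0 LsqD LsqZ LsqN LsqB : lsq.

Ltac lsq := solve [auto 20 with lsq].

Ltac inner_expand := repeat first
  [ rewrite innerDl; [|lsq|lsq|lsq] | rewrite innerDr; [|lsq|lsq|lsq]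
  | rewrite innerZl; [|lsq|lsq] | rewrite innerZr; [|lsq|lsq]
  | rewrite innerNl; [|lsq|lsq] | rewrite innerNr; [|lsq|lsq] ].

(** * Integrals over the line *)

Section LineIntegrals.
Context {R : realType}.
Local Notation mu := (@lebesgue_measure R).
Implicit Types (f g h F : R -> R) (a b : R).

Lemma continuous_int_itv f a b : continuous f ->
  mu.-integrable `[a, b] (EFin \o f).
Proof.
move=> cf; apply: continuous_compact_integrable; first exact: segment_compact.
by apply: continuous_subspaceT.
Qed.

Lemma Rintegral_derive F f a b : (forall x : R, is_derive x 1 F (f x)) ->
  continuous f -> a <= b -> \int[mu]_(x in `[a, b]) f x = F b - F a.
Proof.
move=> dF cf; rewrite le_eqVlt => /predU1P[<-|ab].
  by rewrite subrr set_itv1 Rintegral_set1.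
have cF x : {for x, continuous F}.
  by apply: differentiable_continuous; apply/derivable1_diffP; apply: ex_derive.
rewrite /Rintegral (@continuous_FTC2 _ f F)//.
- exact: continuous_subspaceT.
- split=> [x _||]; first exact: ex_derive.
  + exact: cvg_at_right_filter (cF a).
  + exact: cvg_at_left_filter (cF b).
- by move=> x _; rewrite derive1E derive_val.
Qed.

Lemma derive_ge0_le F f a b : (forall x : R, is_derive x 1 F (f x)) ->
  continuous f -> (forall x, a <= x -> x <= b -> 0 <= f x) -> a <= b -> F a <= F b.
Proof.
move=> dF cf f0 ab; rewrite -subr_ge0 -(Rintegral_derive dF)//.
by apply: Rintegral_ge0 => x /=; rewrite in_itv /= => /andP[]; exact: f0.
Qed.

Lemma Rintegral_cvg_sets f (A : nat -> set R) (D : set R) :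
  measurable D -> (forall n, measurable (A n)) -> (forall n, A n `<=` D) ->
  (forall x, D x -> \forall n \near \oo, A n x) ->
  mu.-integrable D (EFin \o f) ->
  \int[mu]_(x in A n) f x @[n --> \oo] --> \int[mu]_(x in D) f x.
Proof.
move=> mD mA AD nA intf.
have mf := measurable_int _ intf.
have IA n : (\int[mu]_(x in A n) (f x)%:E
    = \int[mu]_(x in D) ((EFin \o f) \_ (A n)) x)%E.
  by rewrite -integral_mkcondr setIC (setIidl (AD n)).
apply: fine_cvg; rewrite fineK; last exact: integrable_fin_num.
under eq_cvg do rewrite IA.
have [] := @dominated_convergence _ _ _ mu D mD (fun n => (EFin \o f) \_ (A n))
  (EFin \o f) (abse \o (EFin \o f)) _ mf _ (integrable_abse intf) _.
- move=> n; apply: (measurable_restrict (EFin \o f) (mA n) mD).1.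
  by apply: measurable_funS mf => //; exact: subIsetl.
- apply/aeW => x Dx; apply: cvg_near_cst.
  by apply: filterS (nA _ Dx) => n /= Anx; rewrite patchE mem_set.
- apply/aeW => x n Dx /=; rewrite patchE; case: ifPn => // _.
  by rewrite abse0.
by move=> _ _.
Qed.

Lemma Rintegral_cvg_sym f : mu.-integrable setT (EFin \o f) ->
  \int[mu]_(x in `[- n%:R, n%:R]) f x @[n --> \oo] --> \int[mu]_x f x.
Proof.
apply: Rintegral_cvg_sets => //.
move=> x _; near=> n; rewrite /= in_itv /= -ler_norml.
by near: n; exact: nbhs_infty_ger.
Unshelve. all: by end_near. Qed.

Lemma Rintegral_le_line f (D : set R) : measurable D -> (forall x, 0 <= f x) ->
  mu.-integrable setT (EFin \o f) -> \int[mu]_(x in D) f x <= \int[mu]_x f x.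
Proof.
move=> mD f0 intf.
have intfD : mu.-integrable D (EFin \o f) by exact: integrableS intf.
rewrite -lee_fin /Rintegral !fineK; [|exact: integrable_fin_num..].
apply: ge0_subset_integral => //; first exact: measurable_int intf.
by move=> x _; rewrite lee_fin.
Qed.

(** By monotone convergence the integral of f is the limit of the increments of F over [-n, n], all
    at most 2 B. This gives integrability of majorants known only through a bounded primitive. *)
Lemma integrable_derive_bounded F f (B : R) : (forall x : R, is_derive x 1 F (f x)) ->
  continuous f -> (forall x, 0 <= f x) -> (forall x, `|F x| <= B) ->
  mu.-integrable setT (EFin \o f).
Proof.
move=> dF cf f0 FB.
have mf := continuous_measurable_fun cf.
apply/integrableP; split; first exact/measurable_EFinP.
pose A (n : nat) := `[- n%:R : R, n%:R]%classic.
have nA x : \forall n \near \oo, A n x.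
  near=> n; rewrite /A /= in_itv /= -ler_norml.
  by near: n; exact: nbhs_infty_ger.
have : (\int[mu]_x ((EFin \o f) \_ (A n)) x)%E @[n --> \oo]
    --> (\int[mu]_x limn (fun n => ((EFin \o f) \_ (A n)) x))%E.
  apply: cvg_monotone_convergence => //.
  - move=> n; apply: (measurable_restrictT (EFin \o f) _).1; first exact: measurable_itv.
    by apply: measurable_funTS; exact/measurable_EFinP.
  - by move=> n x _; rewrite patchE; case: ifP => //=; rewrite lee_fin.
  - move=> x _ m n mn; rewrite !patchE; case: ifPn => [|_].
      rewrite inE /A /= in_itv /= => xm; rewrite ifT// inE /= in_itv /=.
      move: xm; rewrite -!ler_norml => /le_trans; apply.
      by rewrite ler_nat.
    by case: ifP => //=; rewrite lee_fin.
have -> : (fun x => limn (fun n => ((EFin \o f) \_ (A n)) x)) = EFin \o f.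
  apply/funext => x; apply/cvg_lim => //; apply: cvg_near_cst.
  by apply: filterS (nA x) => n Anx; rewrite patchE mem_set.
move=> cvgI.
under eq_integral => x _ do rewrite /= (ger0_norm (f0 x)).
apply: (@le_lt_trans _ _ (2 * B)%:E); last exact: ltry.
rewrite -(cvg_lim _ cvgI)//; apply: lime_le.
  by apply/cvg_ex; eexists; exact: cvgI.
apply: nearW => n; rewrite -integral_mkcond.
have nn : - n%:R <= n%:R :> R by have := ler0n R n; lra.
rewrite -[leLHS]fineK; last first.
  by apply: integrable_fin_num; [exact: measurable_itv|exact: continuous_int_itv].
rewrite lee_fin -[fine _]/(\int[mu]_(x in `[- n%:R, n%:R]) f x) (Rintegral_derive dF)//.
have := FB n%:R; have := FB (- n%:R); rewrite !ler_norml.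
by move=> /andP[? ?] /andP[? ?]; lra.
Unshelve. all: by end_near. Qed.

End LineIntegrals.

(** * Primitives on the line and decay at infinity *)

Section C1L2.
Context {R : realType}.
Local Notation mu := (@lebesgue_measure R).
Implicit Types (f g h F : R -> R) (a b M : R).

Lemma is_derive_continuous f f' : (forall x : R, is_derive x 1 f (f' x)) ->
  continuous f.
Proof.
move=> df x; apply: differentiable_continuous; apply/derivable1_diffP.
exact: ex_derive.
Qed.

Lemma continuous_primitive f : continuous f -> mu.-integrable setT (EFin \o f) ->
  exists F, [/\ forall x : R, is_derive x 1 F (f x),
    F n%:R @[n --> \oo] --> \int[mu]_x f x, F (- n%:R) @[n --> \oo] --> 0 &
    forall x, `|F x| <= \int[mu]_x `|f x| ].
Proof.
move=> cf intf.
have intfS (D : set R) : measurable D -> mu.-integrable D (EFin \o f).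
  by move=> mD; exact: integrableS intf.
pose F x := \int[mu]_(t in `]-oo, x]) f t.
have dF (x : R) : is_derive x 1 F (f x).
  have xx1 : x < x + 1 by rewrite ltrDl.
  have /= := continuous_FTC1 (a := -oo%O) xx1 (intfS _ (measurable_itv _)) _ (cf x).
  move=> h; have [|dx ex] := h; first by rewrite ltNyr.

  by split; [exact: dx|rewrite -derive1E; exact: ex].
have F1 : F n%:R @[n --> \oo] --> \int[mu]_x f x.
  apply: Rintegral_cvg_sets => // x _; near=> n.
  rewrite /= in_itv /=; near: n; exact: nbhs_infty_ger.
exists F; split => //; last first.
  move=> x; apply: le_trans (le_normr_Rintegral _ (intfS _ _)) _ => //.
  by apply: Rintegral_le_line => //; exact: integrable_norm.
(* The limit at -oo follows from the one at +oo: the increment of F over [-n, n] tends to the full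
   integral. *)
have -> : (fun n => F (- n%:R)) =
    (fun n => F n%:R - \int[mu]_(x in `[- n%:R, n%:R]) f x).
  apply/funext => n; rewrite (Rintegral_derive dF)//; first by ring.
  by have := ler0n R n; lra.
rewrite -(subrr (\int[mu]_x f x)); apply: cvgB => //.
exact: Rintegral_cvg_sym.
Unshelve. all: by end_near. Qed.

(** Sobolev embedding of W^{1,1} on an interval of length 1, with increments of the primitives [W]
    and [V] in place of the integrals of |h| and |h'|. On the interval |h| stays above |h x| minus
    the increment of [V]; integrating over length 1 gives the bound. Increments pass to the limit
    easily when the interval moves to infinity. *)
Lemma derive_bound_itv h h' (V W : R -> R) a x :
  (forall x : R, is_derive x 1 h (h' x)) -> continuous h' ->
  (forall x : R, is_derive x 1 V `|h' x|) ->
  (forall x : R, is_derive x 1 W `|h x|) -> a <= x <= a + 1 ->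
  `|h x| <= (W (a + 1) - W a) + (V (a + 1) - V a).
Proof.
move=> dh ch' dV dW /andP[ax xa].
have ch := is_derive_continuous dh.
have cn (u : R -> R) : continuous u -> continuous (fun x => `|u x|).
  by move=> cu y; apply: cvg_norm; exact: cu.
have V_nd s t : s <= t -> V s <= V t.
  by move=> st; apply: (derive_ge0_le dV) => //; exact: cn.
have hV s t : s <= t -> `|h t - h s| <= V t - V s.
  move=> st; rewrite ler_norml; apply/andP; split.
    have : (V + h) s <= (V + h) t; last by rewrite /= !fctE; lra.
    apply: (@derive_ge0_le _ _ (fun y => `|h' y| + h' y)) => //.
      by move=> y; apply: cvgD; [exact: cn|exact: ch'].
    by move=> y _ _; have := ler_norm (- h' y); rewrite normrN; lra.
  have : (V - h) s <= (V - h) t; last by rewrite /= !fctE; lra.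
  apply: (@derive_ge0_le _ _ (fun y => `|h' y| - h' y)) => //.
    by move=> y; apply: cvgB; [exact: cn|exact: ch'].
  by move=> y _ _; have := ler_norm (h' y); lra.
set c := V (a + 1) - V a.
have hc t : a <= t -> t <= a + 1 -> `|h x| - c <= `|h t|.
  move=> at' ta; rewrite lerBlDr -lerBlDl.
  apply: le_trans (lerB_dist _ _) _; rewrite /c.
  have := V_nd _ _ ax; have := V_nd _ _ at'; have := V_nd _ _ xa.
  have := V_nd _ _ ta.
  have [xt|/ltW tx] := leP x t; last by have := hV _ _ tx; lra.
  by have := hV _ _ xt; rewrite distrC; lra.
pose G t := W t - (`|h x| - c) * t.
have : G a <= G (a + 1).
  apply: (@derive_ge0_le _ _ (fun t => `|h t| - (`|h x| - c))) => //.
  - move=> y; rewrite /G; apply: is_deriveB.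
    by apply: is_derive_eq; rewrite /GRing.scale /= mulr1.
  - by move=> y; apply: cvgB; [exact: cn|exact: cvg_cst].
  - by move=> y ya yb; have := hc y ya yb; lra.
  - by rewrite lerDl.
rewrite /G /c; lra.
Qed.

(** The primitives of |h| and |h'| converge at both ends, so their increments over unit intervals
    tend to 0, and these increments control h: the boundary terms disappear. *)
Lemma Rintegral_derive_eq0 h h' : (forall x : R, is_derive x 1 h (h' x)) ->
  continuous h' -> mu.-integrable setT (EFin \o h) ->
  mu.-integrable setT (EFin \o h') -> \int[mu]_x h' x = 0.
Proof.
move=> dh ch' ih ih'.
have ch := is_derive_continuous dh.
have cn (u : R -> R) : continuous u -> continuous (fun x => `|u x|).
  by move=> cu y; apply: cvg_norm; exact: cu.
have [W [dW W1 W2 _]] := continuous_primitive (cn _ ch) (integrable_norm ih).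
have [V [dV V1 V2 _]] := continuous_primitive (cn _ ch') (integrable_norm ih').
pose D (F : R -> R) (x : R) := F (x + 1) - F x.
have lim1 (F : R -> R) (l : R) : F n%:R @[n --> \oo] --> l ->
    D F n%:R @[n --> \oo] --> (0 : R).
  move=> Fl; rewrite -(subrr l); apply: cvgB => //.
  under eq_cvg do rewrite natr1.
  by move: Fl; rewrite -(cvg_shiftS (fun n => F n%:R)).
(* The shift to n + 1 makes the unit interval starting there end at -n. *)
have lim2 (F : R -> R) (l : R) : F (- n%:R) @[n --> \oo] --> l ->
    D F (- n.+1%:R) @[n --> \oo] --> (0 : R).
  move=> Fl; rewrite -(subrr l); apply: cvgB; last first.
    by move: Fl; rewrite -(cvg_shiftS (fun n => F (- n%:R))).
  by under eq_cvg do rewrite -natr1 opprD addrNK.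
have h1 : h n%:R @[n --> \oo] --> (0 : R).
  apply/norm_cvg0P.
  have c0 : D W n%:R + D V n%:R @[n --> \oo] --> (0 : R).
    by rewrite -[X in _ --> X](addr0 0); apply: cvgD; [exact: lim1 W1|exact: lim1 V1].
  apply: (squeeze_cvgr _ (cvg_cst (0 : R)) c0).
  apply: nearW => n; rewrite normr_ge0 /=.
  by apply: (derive_bound_itv dh ch' dV dW); rewrite lexx lerDl ler01.
have h2 : h (- n.+1%:R) @[n --> \oo] --> (0 : R).
  apply/norm_cvg0P.
  have c0 : D W (- n.+1%:R) + D V (- n.+1%:R) @[n --> \oo] --> (0 : R).
    by rewrite -[X in _ --> X](addr0 0); apply: cvgD; [exact: lim2 W2|exact: lim2 V2].
  apply: (squeeze_cvgr _ (cvg_cst (0 : R)) c0).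
  apply: nearW => n; rewrite normr_ge0 /=.
  by apply: (derive_bound_itv dh ch' dV dW); rewrite lexx lerDl ler01.
have := Rintegral_cvg_sym ih'.
have -> : (fun n => \int[mu]_(x in `[- n%:R, n%:R]) h' x)
    = (fun n => h n%:R - h (- n%:R)).
  apply/funext => n; rewrite (Rintegral_derive dh)//.
  by have := ler0n R n; lra.
move=> /(cvg_lim (@norm_hausdorff _ _)) <-; apply/(cvg_lim (@norm_hausdorff _ _)).
rewrite -(subrr 0); apply: cvgB => //.
by rewrite -(cvg_shiftS (fun n => h (- n%:R))).
Qed.

End C1L2.

(** The working class: H^1 functions with a continuous classical derivative. The derivative is an
    argument, so a second-order equation reads as a chain [C1L2 f f'], [C1L2 f' f''] with f''
    explicit. *)
Definition C1L2 {R : realType} (f f' : R -> R) : Prop :=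
  [/\ forall x : R, is_derive x 1 f (f' x), continuous f', Lsq f & Lsq f'].

Section C1L2_theory.
Context {R : realType}.
Local Notation mu := (@lebesgue_measure R).
Implicit Types (f g h F : R -> R) (a b M : R).

Lemma C1L2_continuous f f' : C1L2 f f' -> continuous f.
Proof. by case=> df _ _ _; exact: is_derive_continuous df. Qed.

Lemma C1L2_Lsq f f' : C1L2 f f' -> Lsq f. Proof. by case. Qed.

Lemma C1L2_Lsq' f f' : C1L2 f f' -> Lsq f'. Proof. by case. Qed.

Lemma C1L2D f f' g g' : C1L2 f f' -> C1L2 g g' -> C1L2 (f + g) (f' + g').
Proof.
move=> [df cf Lf Lf'] [dg cg Lg Lg']; split; [| |exact: LsqD|exact: LsqD].
- by move=> x; exact: is_deriveD.
- by move=> x; apply: cvgD; [exact: cf|exact: cg].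
Qed.

Lemma C1L2Z a f f' : C1L2 f f' -> C1L2 (a *: f) (a *: f').
Proof.
move=> [df cf Lf Lf']; split; [| |exact: LsqZ|exact: LsqZ].
- by move=> x; exact: is_deriveZ.
- by move=> x; apply: cvgZr; exact: cf.
Qed.

Lemma C1L2B f f' g g' : C1L2 f f' -> C1L2 g g' -> C1L2 (f - g) (f' - g').
Proof. by move=> ? ?; rewrite -[- g]scaleN1r -[- g']scaleN1r; exact/C1L2D/C1L2Z. Qed.

Lemma C1L2M h h' f f' M : (forall x : R, is_derive x 1 h (h' x)) ->
  continuous h' -> (forall x, `|h x| <= M) -> (forall x, `|h' x| <= M) ->
  C1L2 f f' -> C1L2 (h * f) (h' * f + h * f').
Proof.
move=> dh ch' hM h'M Cf; have cf := C1L2_continuous Cf.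
case: Cf => df cf' Lf Lf'.
have ch := is_derive_continuous dh.
split.
- move=> x; apply: (is_derive_eq (is_deriveM (dh x) (df x))).
  by rewrite /GRing.scale /= !fctE; ring.
- move=> x; apply: cvgD; apply: cvgM; [exact: ch'|exact: cf|exact: ch|exact: cf'].
- by apply: (LsqM _ hM) => //; exact: continuous_measurable_fun.
- apply: LsqD.
    by apply: (LsqM _ h'M) => //; exact: continuous_measurable_fun.
  by apply: (LsqM _ hM) => //; exact: continuous_measurable_fun.
Qed.

Lemma C1L2_ibp f f' g g' : C1L2 f f' -> C1L2 g g' -> inner f' g = - inner f g'.
Proof.
move=> Cf Cg; have cf := C1L2_continuous Cf; have cg := C1L2_continuous Cg.
case: Cf => df cf' Lf Lf'; case: Cg => dg cg' Lg Lg'.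
apply/eqP; rewrite -subr_eq0 opprK; apply/eqP.
have I1 := Lsq_integrableM Lf' Lg; have I2 := Lsq_integrableM Lf Lg'.
rewrite /inner -RintegralD//.
apply: (@Rintegral_derive_eq0 _ (f * g)).
- move=> x; apply: (is_derive_eq (is_deriveM (df x) (dg x))).
  by rewrite /GRing.scale /=; ring.
- move=> x; apply: cvgD; apply: cvgM; [exact: cf'|exact: cg|exact: cf|exact: cg'].
- exact: Lsq_integrableM.
- exact: (integrableD measurableT I1 I2).
Qed.

(** Embedding of H^1 into bounded functions: the unit-interval bound applied to f^2, whose
    derivative satisfies |2 f f'| <= f^2 + f'^2. *)
Lemma C1L2_sup f f' x : C1L2 f f' -> f x ^+ 2 <= 2 * (inner f f + inner f' f').
Proof.
move=> Cf; have cf := C1L2_continuous Cf.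
case: Cf => df cf' Lf Lf'.
have cn (u : R -> R) : continuous u -> continuous (fun x => `|u x|).
  by move=> cu y; apply: cvg_norm; exact: cu.
have I0 := Lsq_integrableM Lf Lf.
have I0' := Lsq_integrableM Lf' Lf'.
have I1 : mu.-integrable setT (EFin \o (2 *: f * f')).
  by apply: Lsq_integrableM => //; exact: LsqZ.
have c1 : continuous (2 *: f * f').
  by move=> y; apply: cvgM; [apply: cvgZr; exact: cf|exact: cf'].
have c0 : continuous (f * f) by move=> y; apply: cvgM; exact: cf.
have [W [dW _ _ _]] := continuous_primitive (cn _ c0) (integrable_norm I0).
have [V [dV _ _ _]] := continuous_primitive (cn _ c1) (integrable_norm I1).
have dff (y : R) : is_derive y 1 (f * f) ((2 *: f * f') y).
  apply: (is_derive_eq (is_deriveM (df y) (df y))).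
  by rewrite -[RHS]/((2 * f y) * f' y) /GRing.scale /=; ring.
have xx : x <= x <= x + 1 by rewrite lexx lerDl ler01.
have := derive_bound_itv dff c1 dV dW xx.
rewrite [X in X <= _](_ : _ = f x ^+ 2); last first.
  by rewrite ger0_norm -[(f * f) x]expr2// sqr_ge0.
have xx1 : x <= x + 1 by rewrite lerDl.
rewrite -(Rintegral_derive dW (cn _ c0) xx1) -(Rintegral_derive dV (cn _ c1) xx1).
move=> /le_trans; apply.
have S0 : \int[mu]_(y in `[x, x + 1]) `|(f * f) y| <= inner f f.
  apply: le_trans (Rintegral_le_line (measurable_itv _)
    (fun y => normr_ge0 _) (integrable_norm I0)) _ => //.
  rewrite le_eqVlt; apply/orP; left; apply/eqP; congr Rintegral.
  by apply/funext => y /=; rewrite ger0_norm// -[(f * f) y]expr2 sqr_ge0.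
suff S1 : \int[mu]_(y in `[x, x + 1]) `|(2 *: f * f') y| <= inner f f + inner f' f'.
  by apply: le_trans (lerD S0 S1) _; have b0 := inner_ge0 f'; clear - b0; lra.
clear W V dW dV; apply: le_trans (Rintegral_le_line (measurable_itv _)
  (fun y => normr_ge0 _) (integrable_norm I1)) _ => //.
rewrite -RintegralD//; apply: le_Rintegral => //.
- exact: integrable_norm.
- exact: (integrableD measurableT I0 I0').
- move=> y _; rewrite -[(2 *: f * f') y]/((2 * f y) * f' y) !normrM.
  rewrite (@ger0_norm _ 2)// -!expr2 -(@real_normK _ (f y)) ?num_real//.
  rewrite -(@real_normK _ (f' y)) ?num_real//.
  by have := sqr_ge0 (`|f y| - `|f' y|); rewrite sqrrB -mulr_natl; lra.
Qed.

End C1L2_theory.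

(** * Hyperbolic functions *)

Section Hyperbolic.
Context {R : realType}.
Implicit Types (th p x y : R).

Definition sech_pow th p x : R := sech (th * x) `^ p.

Definition tanh_sc th x : R :=
  (expR (th * x) - expR (- (th * x))) / (expR (th * x) + expR (- (th * x))).

Lemma expRDN_gt0 x : 0 < expR x + expR (- x).
Proof. by rewrite addr_gt0 ?expR_gt0. Qed.

Lemma sech_gt0 x : 0 < sech x.
Proof. by rewrite divr_gt0 ?expRDN_gt0. Qed.

Lemma sech_le1 x : sech x <= 1.
Proof.
rewrite ler_pdivrMr ?expRDN_gt0// mul1r.
by have := expR_ge1Dx x; have := expR_ge1Dx (- x); lra.
Qed.

Lemma tanh_scE th x : tanh_sc th x ^+ 2 = 1 - sech (th * x) ^+ 2.
Proof.
have h := expRxMexpNx_1 (th * x).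
have d0 := lt0r_neq0 (expRDN_gt0 (th * x)).
rewrite /tanh_sc /sech.
move: h d0; move: (expR (th * x)) (expR (- (th * x))) => u v h d0.
transitivity (((u + v) ^+ 2 - 4 * (u * v)) / (u + v) ^+ 2); first by field.
by rewrite h; field.
Qed.

Lemma normr_tanh_sc th x : `|tanh_sc th x| <= 1.
Proof.
rewrite -(@expr_le1 _ 2)// real_normK ?num_real// tanh_scE.
by have := sqr_ge0 (sech (th * x)); lra.
Qed.

Lemma is_derive_scale th x : is_derive x 1 (fun y => th * y) th.
Proof.
by have := @is_deriveZ _ _ _ id th x 1 1 _; rewrite /GRing.scale /= mulr1; exact.
Qed.

Lemma is_derive_expR_scale th x :
  is_derive x 1 (fun y => expR (th * y)) (th * expR (th * x)).
Proof.
rewrite mulrC; apply: (@is_derive1_comp _ expR (fun y => th * y)).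
exact: is_derive_scale.
Qed.

Lemma is_derive_cosh_sc th x :
  is_derive x 1 ((fun y => expR (th * y)) + (fun y => expR (- (th * y))))
    (th * (expR (th * x) - expR (- (th * x)))).
Proof.
have -> : (fun y => expR (- (th * y))) = (fun y => expR (- th * y)).
  by apply/funext => y; rewrite mulNr.
apply: (is_derive_eq (is_deriveD (is_derive_expR_scale th x)
  (is_derive_expR_scale (- th) x))).
by rewrite !mulNr mulrBr.
Qed.

Lemma is_derive_sech th x : is_derive x 1 (fun y => sech (th * y))
  (- th * tanh_sc th x * sech (th * x)).
Proof.
have c0 : ((fun y => expR (th * y)) + (fun y => expR (- (th * y)))) x != 0.
  exact: lt0r_neq0 (expRDN_gt0 (th * x)).
have := is_deriveZ 2 (is_deriveV c0 (is_derive_cosh_sc th x)).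
move=> h; apply: (is_derive_eq h).
rewrite /GRing.scale /= /tanh_sc /sech.
by move: c0; rewrite !fctE; move: (expR (th * x)) (expR (- (th * x))) => u v c0; field.
Qed.

Lemma is_derive_tanh_sc th x : is_derive x 1 (tanh_sc th)
  (th * sech (th * x) ^+ 2).
Proof.
have c0 : ((fun y => expR (th * y)) + (fun y => expR (- (th * y)))) x != 0.
  exact: lt0r_neq0 (expRDN_gt0 (th * x)).
have dsh : is_derive x 1 ((fun y => expR (th * y)) - (fun y => expR (- (th * y))))
    (th * (expR (th * x) + expR (- (th * x)))).
  have -> : (fun y => expR (- (th * y))) = (fun y => expR (- th * y)).
    by apply/funext => y; rewrite mulNr.
  apply: (is_derive_eq (is_deriveB (is_derive_expR_scale th x)
    (is_derive_expR_scale (- th) x))).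
  by rewrite !mulNr mulrDr opprK.
have := is_deriveM dsh (is_deriveV c0 (is_derive_cosh_sc th x)).
move=> h; apply: (is_derive_eq h).
rewrite /GRing.scale /= !fctE /sech.
have := expRxMexpNx_1 (th * x).
move: c0; rewrite !fctE; move: (expR (th * x)) (expR (- (th * x))) => u v c0 uv.
transitivity (th * (4 * (u * v)) / (u + v) ^+ 2); first by field.
by rewrite uv; field.
Qed.

Lemma sech_pow_gt0 th p x : 0 < sech_pow th p x.
Proof. by rewrite powR_gt0// sech_gt0. Qed.

Lemma sech_pow_le1 th p x : 0 <= p -> sech_pow th p x <= 1.
Proof.
move=> p0; rewrite /sech_pow -(powRr0 (sech (th * x))).
by apply: ger_powR => //; rewrite sech_gt0 sech_le1.
Qed.

Lemma normr_sech_pow th p x : 0 <= p -> `|sech_pow th p x| <= 1.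
Proof. by move=> p0; rewrite ger0_norm ?sech_pow_le1// ltW// sech_pow_gt0. Qed.

Lemma sech_powD th p q : sech_pow th p * sech_pow th q = sech_pow th (p + q).
Proof.
apply/funext => x; rewrite /sech_pow powRD//.
by rewrite (lt0r_neq0 (sech_gt0 _)) implybT.
Qed.

Lemma sech_pow_nat th n x : sech_pow th n%:R x = sech (th * x) ^+ n.
Proof. by rewrite /sech_pow powR_mulrn// ltW// sech_gt0. Qed.

Lemma tanh_sqE th : tanh_sc th * tanh_sc th = 1 - sech_pow th 2.
Proof.
by apply/funext => x; rewrite !fctE sech_pow_nat -tanh_scE expr2.
Qed.

Lemma is_derive_sech_pow th p x : is_derive x 1 (sech_pow th p)
  (- (p * th) * (tanh_sc th x * sech_pow th p x)).
Proof.
have s0 := sech_gt0 (th * x).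
apply: (is_derive_eq (@is_derive1_comp _ (fun y => y `^ p) (fun y => sech (th * y)) x _ _
  (is_derive1_powR p s0) (is_derive_sech th x))).
have -> : sech_pow th p x = sech (th * x) * sech (th * x) `^ (p - 1).
  rewrite /sech_pow -{2}(powRr1 (ltW s0)) -powRD ?(lt0r_neq0 s0) ?implybT//.
  by rewrite addrC subrK.
ring.
Qed.

Lemma continuous_sech_pow th p : continuous (sech_pow th p).
Proof. exact: is_derive_continuous (is_derive_sech_pow th p). Qed.

Lemma continuous_tanh_sc th : continuous (tanh_sc th).
Proof. exact: is_derive_continuous (is_derive_tanh_sc th). Qed.

Lemma tanh_sc_gt0 th : 0 < th -> 0 < tanh_sc th 1.
Proof.
move=> th0; rewrite divr_gt0 ?expRDN_gt0// subr_gt0 ltr_expR; lra.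
Qed.

Lemma tanh_scN th x : tanh_sc th (- x) = - tanh_sc th x.
Proof.
rewrite /tanh_sc mulrN opprK; move: (expR (th * x)) (expR (- (th * x))) => u v.
by rewrite [v + u]addrC -mulNr opprB.
Qed.

Lemma tanh_sc_le th x y : 0 < th -> x <= y -> tanh_sc th x <= tanh_sc th y.
Proof.
move=> th0; apply: (derive_ge0_le (is_derive_tanh_sc th)).
  move=> z; apply: cvgM; first exact: cvg_cst.
  by apply: cvgM; exact: (is_derive_continuous (is_derive_sech th)).
by move=> z _ _; rewrite mulr_ge0 ?sqr_ge0 ?ltW.
Qed.

(** No closed primitive of sech^q, q = 2 p, is available for real p, so a majorant is integrated
    instead. The derivative of tanh sech^q is th ((1 + q) sech^2 sech^q - q sech^q); subtracting it
    from that of (1 + q) tanh leaves th times q sech^q plus the nonnegative (1 + q) sech^2 (1 -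
    sech^q), and the primitive is bounded. *)
Lemma Lsq_sech_pow th p : 0 < th -> 0 < p -> Lsq (sech_pow th p).
Proof.
move=> th0 p0; set q := 2 * p; have q0 : 0 < q by rewrite mulr_gt0.
pose Phi := (q * th)^-1 *: ((1 + q) *: tanh_sc th - tanh_sc th * sech_pow th q).
pose phi := q^-1 *: (q *: sech_pow th q +
  (1 + q) *: (sech_pow th 2 - sech_pow th 2 * sech_pow th q)).
have dPhi (x : R) : is_derive x 1 Phi (phi x).
  have h := is_deriveM (is_derive_tanh_sc th x) (is_derive_sech_pow th q x).
  have := is_deriveZ (q * th)^-1 (is_deriveB (is_deriveZ (1 + q) (is_derive_tanh_sc th x)) h).
  move=> {}h; apply: (is_derive_eq h).
  rewrite -[phi x]/(q^-1 * (q * sech_pow th q x +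
    (1 + q) * (sech_pow th 2 x - sech_pow th 2 x * sech_pow th q x))) sech_pow_nat.
  transitivity ((q * th)^-1 * (th * ((1 + q) * (sech (th * x) ^+ 2)
     + q * (tanh_sc th x ^+ 2) * sech_pow th q x - sech (th * x) ^+ 2 * sech_pow th q x))).
    by rewrite /GRing.scale /=; ring.
  by rewrite tanh_scE /GRing.scale /=; field; rewrite !lt0r_neq0.
have le_phi x : 0 <= sech_pow th q x <= phi x.
  rewrite ltW ?sech_pow_gt0//= -[phi x]/(q^-1 * (q * sech_pow th q x +
    (1 + q) * (sech_pow th 2 x - sech_pow th 2 x * sech_pow th q x))) mulrDr mulKf ?lt0r_neq0//.
  rewrite lerDl; apply: mulr_ge0; first by rewrite invr_ge0 ltW.
  apply: mulr_ge0; first by rewrite addr_ge0// ltW.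
  rewrite -{1}[sech_pow th 2 x]mulr1 -mulrBr; apply: mulr_ge0.
    exact/ltW/sech_pow_gt0.
  by rewrite subr_ge0 sech_pow_le1// ltW.
have iphi : lebesgue_measure.-integrable setT (EFin \o phi).
  apply: (integrable_derive_bounded dPhi (B := (q * th)^-1 * (2 + q))).
  - move=> x; apply: cvgZr; apply: cvgD; first by apply: cvgZr; exact: continuous_sech_pow.
    apply: cvgZr; apply: cvgB; first exact: continuous_sech_pow.
    by apply: cvgM; exact: continuous_sech_pow.
  - by move=> x; case/andP: (le_phi x); exact: le_trans.
  - move=> x; have iq : 0 <= (q * th)^-1 by rewrite invr_ge0; apply: mulr_ge0; exact: ltW.
    rewrite /Phi -[_ x]/((q * th)^-1 * ((1 + q) * tanh_sc th x - tanh_sc th x * sech_pow th q x)).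
    rewrite normrM ger0_norm// ler_wpM2l//; apply: le_trans (ler_normB _ _) _.
    have -> : 2 + q = (1 + q) * 1 + 1 * 1 by ring.
    rewrite [X in X + _]normrM [X in _ + X]normrM; apply: lerD.
      have q1 : 0 <= 1 + q by rewrite addr_ge0// ltW.
      by rewrite (ger0_norm q1); apply: ler_wpM2l => //; exact: normr_tanh_sc.
    by apply: ler_pM => //; [exact: normr_tanh_sc|exact: (normr_sech_pow th x (ltW q0))].
have mS := continuous_measurable_fun (@continuous_sech_pow th p).
apply/LsqP; split => //.
apply: (le_integrable measurableT _ _ iphi).
  by apply/measurable_EFinP; exact: measurable_funX.
move=> x _ /=; rewrite lee_fin.
have -> : sech_pow th p x ^+ 2 = sech_pow th q x.
  by rewrite /q mulr_natl mulr2n -sech_powD expr2.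
case/andP: (le_phi x) => S0 Sphi; rewrite (ger0_norm S0) ger0_norm//.
exact: le_trans S0 Sphi.
Qed.

End Hyperbolic.

(** * Ladder operators and spectral gaps *)

Section LadderOperators.
Context {R : realType}.
Local Notation mu := (@lebesgue_measure R).
Variable th : R.
Hypothesis th0 : 0 < th.
Local Notation T := (tanh_sc th).
Local Notation S := (sech_pow th).
Implicit Types (p x : R) (f g z : R -> R).

Lemma measurable_tanh_sc : measurable_fun setT T.
Proof. exact: continuous_measurable_fun (@continuous_tanh_sc _ th). Qed.

Lemma measurable_sech_pow p : measurable_fun setT (S p).
Proof. exact: continuous_measurable_fun (@continuous_sech_pow _ th p). Qed.

Lemma Lsq_tanh f : Lsq f -> Lsq (T * f).
Proof. exact: LsqM measurable_tanh_sc (@normr_tanh_sc _ th). Qed.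

Lemma Lsq_sechM p f : 0 <= p -> Lsq f -> Lsq (S p * f).
Proof.
move=> p0; exact: LsqM (measurable_sech_pow p) (fun x => normr_sech_pow th x p0).
Qed.

Lemma C1L2_sech_pow p : 0 < p -> C1L2 (S p) (- (p * th) *: (T * S p)).
Proof.
move=> p0; have Lg := Lsq_sech_pow th0 p0; split => //.
- by move=> x; exact: is_derive_sech_pow.
- move=> x; apply: cvgZr; apply: cvgM; first exact: continuous_tanh_sc.
  exact: continuous_sech_pow.
- by apply: LsqZ; exact: Lsq_tanh.
Qed.

Lemma C1L2_tanh f f' : C1L2 f f' -> C1L2 (T * f) (th *: (S 2 * f) + T * f').
Proof.
move=> Cf; have -> : th *: (S 2 * f) = (th *: S 2) * f.
  by apply/funext => x; exact: mulrA.
apply: (@C1L2M _ T (th *: S 2) f f' (1 + th)) => [x||x|x|]; last exact: Cf.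
- apply: (is_derive_eq (is_derive_tanh_sc th x)).
  by rewrite -[RHS]/(th * S 2 x) sech_pow_nat.
- by move=> x; apply: cvgZr; exact: continuous_sech_pow.
- by apply: le_trans (normr_tanh_sc th x) _; rewrite lerDl ltW.
- rewrite -[(th *: S 2) x]/(th * S 2 x) normrM (ger0_norm (ltW th0)).
  apply: (@le_trans _ _ (th * 1)); last by rewrite mulr1 lerDr.
  by rewrite ler_pM2l//; exact: normr_sech_pow.
Qed.

(** With t = tanh and s = sech^2, the factor of [kap] is the derivative of tanh y^2, so it only
    contributes bounded boundary terms. For p >= 1 the difference of the two sides is the square of
    B_{p-1} y, a pointwise form of the commutation relation. For p < 1, where 2 p - 1 may fail to be
    positive, another multiple of the same derivative leaves y'^2 + p (1 - p) th^2 s y^2. *)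
Lemma conj_pointwise p : 0 < p -> exists2 b, 0 < b & exists kap, forall t s y y' : R,
  0 <= s -> t ^+ 2 = 1 - s ->
  b * y ^+ 2 <= (- y' + p * th * t * y) ^+ 2
    + kap * (th * s * y ^+ 2 + 2 * t * y * y').
Proof.
move=> p0; have [p1|p1] := leP 1 p.
  exists ((2 * p - 1) * th ^+ 2).
    by rewrite mulr_gt0 ?exprn_gt0//; lra.
  exists ((2 * p - 1) * th) => t s y y' s0 ts.
  rewrite -subr_ge0 (_ : _ - _ = (y' + (p - 1) * th * t * y) ^+ 2 +
     (2 * p - 1) * th ^+ 2 * y ^+ 2 * (t ^+ 2 - (1 - s))); last by ring.
  by rewrite ts subrr mulr0 addr0 sqr_ge0.
exists (p ^+ 2 * th ^+ 2); first by rewrite mulr_gt0 ?exprn_gt0.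
exists (p * th) => t s y y' s0 ts.
rewrite -subr_ge0 (_ : _ - _ = y' ^+ 2 + p * (1 - p) * (th ^+ 2 * s * y ^+ 2) +
   p ^+ 2 * th ^+ 2 * y ^+ 2 * (t ^+ 2 - (1 - s))); last by ring.
rewrite ts subrr mulr0 addr0 addr_ge0 ?sqr_ge0//.
apply: mulr_ge0; first by rewrite mulr_ge0 ?subr_ge0 ?ltW.
by rewrite mulr_ge0 ?sqr_ge0// mulr_ge0 ?sqr_ge0.
Qed.

Lemma cvg0_ge0 (u : nat -> R) (c : R) : u n @[n --> \oo] --> (0 : R) ->
  (\forall n \near \oo, u n <= c) -> 0 <= c.
Proof.
move=> u0 uc; rewrite -(cvg_lim (@norm_hausdorff _ _) u0).
by apply: limr_le => //; apply/cvg_ex; exists 0.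
Qed.

(** A barrier argument. On |x| >= 1 one has |T| >= T 1, so the derivative of kap S^p dominates S^p z
    once kap p th T 1 = M. Hence kap S^p + F and kap S^p - F are monotone on each half-line,
    decreasing outwards, and bounded below by functions vanishing at infinity. *)
Lemma ladder_tail p z (F : R -> R) (M : R) : 0 < p -> continuous z ->
  (forall x, `|z x| <= M) -> (forall x : R, is_derive x 1 F (- (S p x * z x))) ->
  F n%:R @[n --> \oo] --> (0 : R) -> F (- n%:R) @[n --> \oo] --> (0 : R) ->
  forall x, 1 <= `|x| -> `|F x| <= M / (p * th * T 1) * S p x.
Proof.
move=> p0 cz zM dF F1 F2 x x1.
have T1 := tanh_sc_gt0 th0.
set kap := M / _.
have kapE : kap * (p * th) * T 1 = M.
  rewrite /kap -mulrA divfK//.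
  exact: lt0r_neq0 (mulr_gt0 (mulr_gt0 p0 th0) T1).
have M0 : 0 <= M by apply: le_trans (zM 0).
have kap0 : 0 <= kap * (p * th).
  by rewrite -(pmulr_lge0 _ T1) kapE.
have kap1 : 0 <= kap by rewrite -(pmulr_lge0 _ (mulr_gt0 p0 th0)).
have main (s : R) : `|s| = 1 -> 0 <= kap * S p x + s * F x.
  move=> s1; pose G y := kap * S p y + s * F y.
  pose G' y := S p y * (- (kap * (p * th) * T y) - s * z y).
  have dG (y : R) : is_derive y 1 G (G' y).
    apply: (is_derive_eq (is_deriveD (is_deriveZ kap (is_derive_sech_pow th p y))
      (is_deriveZ s (dF y)))).
    by rewrite /G' /GRing.scale /=; ring.
  have cG' : continuous G'.
    move=> y; apply: cvgM; first exact: continuous_sech_pow.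
    apply: cvgB; last by apply: cvgZr; exact: cz.
    by apply: cvgN; apply: cvgZr; exact: continuous_tanh_sc.
  have szM y : `|s * z y| <= M by rewrite normrM s1 mul1r.
  have kS y : 0 <= kap * S p y by rewrite mulr_ge0// ltW// sech_pow_gt0.
  have sF (u : nat -> R) : F (u n) @[n --> \oo] --> (0 : R) ->
      s * F (u n) @[n --> \oo] --> (0 : R).
    by move=> Fu; rewrite -(mulr0 s); apply: cvgZr.
  have [xp|xn] : 1 <= x \/ x <= -1.
    by move: x1; rewrite ler_normr => /orP[]; [left|right; lra].
  - apply: (cvg0_ge0 (sF _ F1)); near=> n.
    have xn : x <= n%:R by near: n; exact: nbhs_infty_ger.
    have : (- G) x <= (- G) n%:R.
      apply: (derive_ge0_le (fun y => is_deriveN (dG y))) => //.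
        by move=> y; apply: cvgN; exact: cG'.
      move=> y xy _; rewrite oppr_ge0 /G' pmulr_rle0 ?sech_pow_gt0//.
      have := tanh_sc_le th0 (le_trans xp xy); have := szM y.
      rewrite ler_norml => /andP[h _] /(ler_wpM2l kap0); rewrite kapE; lra.
    rewrite -[(- G) x]/(- G x) -[(- G) n%:R]/(- G n%:R) lerN2 => /(le_trans _); apply.
    by rewrite /G lerDr.
  - apply: (cvg0_ge0 (sF _ F2)); near=> n.
    have xn' : - n%:R <= x.
      have : - x <= n%:R by near: n; exact: nbhs_infty_ger.
      lra.
    have : G (- n%:R) <= G x.
      apply: (@derive_ge0_le _ _ G') => // y _ yx.
      rewrite /G' mulr_ge0 ?(ltW (sech_pow_gt0 _ _ _))//.
      have := tanh_sc_le th0 (le_trans yx xn); rewrite tanh_scN => /(ler_wpM2l kap0).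
      by rewrite mulrN kapE; have := szM y; rewrite ler_norml => /andP[_]; lra.
    by apply: le_trans; rewrite /G lerDr.
rewrite ler_norml; apply/andP; split.
  by have := main 1 (normr1 _); lra.
by have := main (-1) (normrN1 _); lra.
Unshelve. all: by end_near. Qed.

End LadderOperators.

#[global] Hint Resolve Lsq_tanh Lsq_sechM : lsq.

(** * Inverting the adjoint ladder operators *)

Section Gap.
Context {R : realType}.
Local Notation mu := (@lebesgue_measure R).
Variable th : R.
Hypothesis th0 : 0 < th.
Local Notation T := (tanh_sc th).
Local Notation S := (sech_pow th).
Implicit Types (p x : R) (f g z : R -> R).

(* As (S^p y)' = - S^p z, the preimage is y = S^-p \int_x^{+oo} S^p z; it is
   bounded because S^p z has zero mean, and square integrable because of the
   pointwise inequality [conj_pointwise]. *)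
Lemma conj_ladder_preimage p z z' : 0 < p -> C1L2 z z' -> inner (S p) z = 0 ->
  exists y y', C1L2 y y' /\ z = - y' + (p * th) *: (T * y).
Proof.
move=> p0 Cz Sz; have cz := C1L2_continuous Cz.
have Lz := C1L2_Lsq Cz.
have LS := Lsq_sech_pow th0 p0.
have [M zM] : exists M, forall x, `|z x| <= M.
  exists (1 + 2 * (inner z z + inner z' z')) => x.
  have := C1L2_sup x Cz; rewrite -real_normK ?num_real//.
  have := sqr_ge0 (`|z x| - 1); have := normr_ge0 (z x); nra.
have If : mu.-integrable setT (EFin \o (- (S p * z))).
  rewrite (_ : - (S p * z) = (-1 *: S p) * z); last first.
    by apply/funext => x; rewrite -[LHS]/(- (S p x * z x)) -[RHS]/(-1 * S p x * z x); ring.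
  by apply: Lsq_integrableM => //; exact: LsqZ.
have cf : continuous (- (S p * z)).
  by move=> x; apply: cvgN; apply: cvgM; [exact: continuous_sech_pow|exact: cz].
have [F [dF F1 F2 _]] := continuous_primitive cf If.
have If0 : \int[mu]_x (- (S p * z)) x = 0.
  transitivity (inner (-1 *: S p) z).
    congr Rintegral; apply/funext => x.
    by rewrite -[RHS]/(-1 * S p x * z x) -[LHS]/(- (S p x * z x)); ring.
  by rewrite innerZl// Sz mulr0.
rewrite {}If0 in F1.
have tail := ladder_tail th0 p0 cz zM dF F1 F2.
pose y : R -> R := F * (fun x => (S p x)^-1).
pose y' : R -> R := - z + (p * th) *: (T * y).
have yE x : y x = F x / S p x by [].
have dy (x : R) : is_derive x 1 y (y' x).
  have s0 := lt0r_neq0 (sech_pow_gt0 th p x).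
  apply: (is_derive_eq (is_deriveM (dF x) (is_deriveV s0 (is_derive_sech_pow th p x)))).
  rewrite -[y' x]/(- z x + p * th * (T x * (F x / S p x))) /GRing.scale /=.
  rewrite -[(- (S p * z)) x]/(- (S p x * z x)).
  by move: s0; move: (S p x) (T x) => s t s0; field.
have cy := is_derive_continuous dy.
have cy' : continuous y'.
  move=> x; apply: cvgD; first by apply: cvgN; exact: cz.
  by apply: cvgZr; apply: cvgM; [exact: continuous_tanh_sc|exact: cy].
have [K yK] : exists K, forall x, `|y x| <= K.
  have cny : continuous (fun x => `|y x|) by move=> x; apply: cvg_norm; exact: cy.
  have [] := @EVT_max R (fun x => `|y x|) (-1) 1.
  - by lra.
  - exact: continuous_subspaceT.
  move=> c _ yc; exists (`|y c| + M / (p * th * T 1)) => x.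
  have kap1 : 0 <= M / (p * th * T 1).
    rewrite divr_ge0 ?(le_trans _ (zM 0))//.
    by rewrite ltW// (mulr_gt0 (mulr_gt0 p0 th0))// tanh_sc_gt0.
  have [x1|/ltW x1] := leP 1 `|x|.
    apply: (@le_trans _ _ (M / (p * th * T 1))); last by rewrite lerDr.
    rewrite yE normrM normfV (ger0_norm (ltW (sech_pow_gt0 _ _ _))).
    by rewrite ler_pdivrMr ?sech_pow_gt0//; exact: tail.
  apply: (@le_trans _ _ `|y c|); last by rewrite lerDl.
  by apply: yc; rewrite in_itv /= -ler_norml.
have [b b0 [kap key]] := conj_pointwise th0 p0.
have Ly : Lsq y.
  have czz : continuous (z * z) by move=> x; apply: cvgM; exact: cz.
  have [Z [dZ _ _ ZM]] := continuous_primitive czz (Lsq_integrableM Lz Lz).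
  (* The majorant of y^2 from [conj_pointwise]. Its primitive is bounded because z is square
     integrable and y and tanh are bounded. *)
  pose phi (x : R) := b^-1 * (z x ^+ 2 + kap * (th * S 2 x * y x ^+ 2 + 2 * T x * y x * y' x)).
  pose Phi : R -> R := b^-1 *: (Z + kap *: (T * (y * y))).
  have dPhi (x : R) : is_derive x 1 Phi (phi x).
    have := is_deriveM (is_derive_tanh_sc th x) (is_deriveM (dy x) (dy x)).
    move=> h; have := is_deriveZ b^-1 (is_deriveD (dZ x) (is_deriveZ kap h)).
    move=> {}h; apply: (is_derive_eq h).
    rewrite /phi /GRing.scale /= sech_pow_nat.
    by rewrite -[(z * z) x]/(z x * z x) -[(y * y) x]/(y x * y x); ring.
  have le_phi x : y x ^+ 2 <= phi x.
    rewrite /phi ler_pdivlMl//.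
    have -> : z x = - y' x + p * th * T x * y x.
      by rewrite -[y' x]/(- z x + p * th * (T x * y x)); ring.
    apply: key; first exact/ltW/sech_pow_gt0.
    by rewrite tanh_scE sech_pow_nat.
  have iphi : mu.-integrable setT (EFin \o phi).
    apply: (integrable_derive_bounded dPhi
      (B := b^-1 * (\int[mu]_x `|(z * z) x| + `|kap| * K ^+ 2))).
    - move=> x; apply: cvgM; first exact: cvg_cst.
      apply: cvgD; first by apply: cvgM; exact: cz.
      apply: cvgM; first exact: cvg_cst.
      have c2 : {for x, continuous (S 2)} by exact: continuous_sech_pow.
      have c3 : {for x, continuous T} by exact: continuous_tanh_sc.
      apply: cvgD; apply: cvgM.
      + by apply: cvgM; [exact: cvg_cst|exact: c2].
      + by apply: cvgM; exact: cy.
      + by apply: cvgM; [apply: cvgM; [exact: cvg_cst|exact: c3]|exact: cy].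
      + exact: cy'.
    - by move=> x; apply: le_trans (le_phi x); exact: sqr_ge0.
    - move=> x; rewrite -[Phi x]/(b^-1 * (Z x + kap * (T x * (y x * y x)))).
      have ib : 0 <= b^-1 by rewrite invr_ge0 ltW.
      rewrite normrM (ger0_norm ib); apply: ler_wpM2l => //.
      apply: le_trans (ler_normD _ _) _; apply: lerD; first exact: ZM.
      rewrite normrM; apply: ler_wpM2l => //; rewrite -[K ^+ 2]mul1r normrM.
      apply: ler_pM => //; first exact: normr_tanh_sc.
      by rewrite normrM expr2 ler_pM.
  have my := continuous_measurable_fun cy.
  apply/LsqP; split => //.
  apply: (le_integrable measurableT _ _ iphi).
    by apply/measurable_EFinP; exact: measurable_funX.
  move=> x _ /=; rewrite lee_fin (ger0_norm (sqr_ge0 _)).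
  exact: le_trans (le_phi x) (ler_norm _).
exists y, y'; split.
  split => //; apply: LsqD; first exact: LsqN.
  by apply: LsqZ; exact: Lsq_tanh.
by rewrite /y' opprD opprK subrK.
Qed.

(** Duality: a lower bound m for B B^* passes to B^* B on the range of B^*. For z = B^* y one has
    |z|^2 = <B z, y> <= |B z| |y|, and m |y|^2 <= |z|^2 concludes. *)
Lemma ladder_gap p m z z' : 0 < p -> C1L2 z z' -> inner (S p) z = 0 ->
  (forall y y', C1L2 y y' -> z = - y' + (p * th) *: (T * y) ->
    m * inner y y <= inner z z) ->
  m * inner z z <= inner (z' + (p * th) *: (T * z)) (z' + (p * th) *: (T * z)).
Proof.
move=> p0 Cz Sz ym; have [y [y' [Cy zE]]] := conj_ladder_preimage p0 Cz Sz.
have {}ym := ym _ _ Cy zE.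
have [Lz Lz'] := (C1L2_Lsq Cz, C1L2_Lsq' Cz).
have [Ly Ly'] := (C1L2_Lsq Cy, C1L2_Lsq' Cy).
set B := z' + _.
have LB : Lsq B by apply: LsqD => //; apply: LsqZ; exact: Lsq_tanh.
have zB : inner z z = inner B y.
  have Lzy : Lsq (- y' + (p * th) *: (T * y)) by lsq.
  rewrite {2}zE /B; inner_expand.
  by rewrite -(C1L2_ibp Cz Cy) inner_mull.
have := inner_CS LB Ly; rewrite -zB.
have := inner_ge0 z; have := inner_ge0 y; have := inner_ge0 B.
move: (inner z z) (inner y y) (inner B B) ym => zz yy BB ym BB0 yy0 zz0 CS.
have [m0|m0] := leP m 0.
  by apply: le_trans BB0; rewrite mulr_le0_ge0.
have [zz1|zz1] := ltP 0 zz; last by have -> : zz = 0; [lra|rewrite mulr0].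
rewrite -(ler_pM2r zz1) -mulrA -expr2.
apply: (@le_trans _ _ (m * (BB * yy))); first by rewrite ler_pM2l.
by rewrite mulrCA ler_wpM2l.
Qed.

End Gap.

(** * Spectral gaps of the ladder operators and of the soliton operator *)

Section SpectralGaps.
Context {R : realType}.
Variable th : R.
Hypothesis th0 : 0 < th.
Local Notation T := (tanh_sc th).
Local Notation S := (sech_pow th).
Local Notation "''B_' p ( z , z' )" := (z' + (p * th) *: (T * z))
  (at level 8, p at level 2).
Implicit Types (p x : R) (f g z : R -> R).

(** The integral of the derivative of tanh y^2 vanishes. *)
Lemma inner_tanh y y' : C1L2 y y' -> inner y' (T * y) = - (th / 2) * inner (S 2 * y) y.
Proof.
move=> Cy; have := C1L2_ibp Cy (C1L2_tanh th0 Cy).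
have [Ly Ly'] := (C1L2_Lsq Cy, C1L2_Lsq' Cy).
have LS : Lsq (S 2 * y) by apply: Lsq_sechM.
inner_expand; rewrite (innerC y (S 2 * y)) (innerC y (T * y')) (inner_mull T); lra.
Qed.

Lemma inner_tanh_tanh f g : Lsq f -> Lsq g ->
  inner (T * f) (T * g) = inner f g - inner (S 2 * f) g.
Proof.
move=> Lf Lg; have LS : Lsq (S 2 * f) by apply: Lsq_sechM.
rewrite inner_mull mulrA (innerC f) tanh_sqE mulrBl mul1r.
rewrite innerC innerDr ?innerNr//; [|exact: Lsq_sechM|exact/LsqN/Lsq_sechM].
by rewrite (innerC f (S 2 * g)) inner_mull (innerC g).
Qed.

Lemma ladder_norm p z z' : C1L2 z z' ->
  inner 'B_p(z, z') 'B_p(z, z') = inner z' z' + (p * th) ^+ 2 * inner z z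
    - p * (p + 1) * th ^+ 2 * inner (S 2 * z) z.
Proof.
move=> Cz; have [Lz Lz'] := (C1L2_Lsq Cz, C1L2_Lsq' Cz).
inner_expand; rewrite (innerC (T * z) z') (inner_tanh Cz) inner_tanh_tanh//.
by field.
Qed.

(** Against [ladder_norm], the sign of the cross term flips and p (p + 1) becomes p (p - 1), the
    coefficient of [ladder_norm] at p - 1; the commutation relation rests on this. *)
Lemma conj_norm p y y' : C1L2 y y' ->
  inner (- y' + (p * th) *: (T * y)) (- y' + (p * th) *: (T * y)) =
    inner y' y' + (p * th) ^+ 2 * inner y y
    - p * (p - 1) * th ^+ 2 * inner (S 2 * y) y.
Proof.
move=> Cy; have [Ly Ly'] := (C1L2_Lsq Cy, C1L2_Lsq' Cy).
inner_expand; rewrite (innerC (T * y) y') (inner_tanh Cy) inner_tanh_tanh//.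
by field.
Qed.

Lemma inner_sech_ge0 f : Lsq f -> 0 <= inner (S 2 * f) f.
Proof.
move=> Lf; apply: Rintegral_ge0 => x _.
rewrite -[(S 2 * f) x]/(S 2 x * f x) -mulrA mulr_ge0 ?(ltW (sech_pow_gt0 _ _ _))//.
by rewrite -expr2 sqr_ge0.
Qed.

(** For p <= 1 the term in sech^2 of B_p B_p^* has the nonnegative coefficient p (1 - p) th^2, so
    the constant (p th)^2 alone is a lower bound. *)
Lemma ladder_gap_lt1 p z z' : 0 < p -> p <= 1 -> C1L2 z z' -> inner (S p) z = 0 ->
  (p * th) ^+ 2 * inner z z <= inner 'B_p(z, z') 'B_p(z, z').
Proof.
move=> p0 p1 Cz Sz; apply: ladder_gap => // y y' Cy ->.
have Ly := C1L2_Lsq Cy.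
rewrite (conj_norm p Cy) -subr_ge0.
rewrite (_ : _ - _ = inner y' y' + p * (1 - p) * (th ^+ 2 * inner (S 2 * y) y)); last by ring.
rewrite addr_ge0 ?inner_ge0// mulr_ge0//.
  by rewrite mulr_ge0 ?subr_ge0// ltW.
by rewrite mulr_ge0 ?sqr_ge0// inner_sech_ge0.
Qed.

Lemma ladder_gap_ge1 p z z' : 1 <= p -> C1L2 z z' -> inner (S p) z = 0 ->
  (2 * p - 1) * th ^+ 2 * inner z z <= inner 'B_p(z, z') 'B_p(z, z').
Proof.
move=> p1 Cz Sz; apply: ladder_gap => // [|y y' Cy ->]; first by lra.
rewrite (conj_norm p Cy) -subr_ge0.
have := inner_ge0 'B_(p - 1)(y, y'); rewrite (ladder_norm (p - 1) Cy).
by move=> /le_trans; apply; rewrite le_eqVlt; apply/orP; left; apply/eqP; ring.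
Qed.

Lemma ladder_gap_gt0 p : 0 < p -> exists2 b, 0 < b & forall z z', C1L2 z z' ->
  inner (S p) z = 0 -> b * inner z z <= inner 'B_p(z, z') 'B_p(z, z').
Proof.
move=> p0; have [p1|p1] := leP 1 p.
  exists ((2 * p - 1) * th ^+ 2); first by rewrite mulr_gt0 ?exprn_gt0//; lra.
  by move=> z z'; exact: ladder_gap_ge1.
exists ((p * th) ^+ 2); first by rewrite exprn_gt0// mulr_gt0.
by move=> z z'; apply: ladder_gap_lt1 => //; exact: ltW.
Qed.

(** Two rungs of the ladder. Since B_3 maps tanh sech^2 to th sech^2, the second orthogonality says
    that the preimage y is orthogonal to sech^2, the kernel of B_2. Then 8 = 5 + 3: the commutation
    constant at p = 3 plus the gap of B_2. *)
Lemma ladder3_gap z z' : C1L2 z z' -> inner (S 3) z = 0 -> inner (T * S 2) z = 0 ->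
  8 * th ^+ 2 * inner z z <= inner 'B_3(z, z') 'B_3(z, z').
Proof.
move=> Cz S3z TSz; apply: ladder_gap => // y y' Cy zE.
have [Ly Ly'] := (C1L2_Lsq Cy, C1L2_Lsq' Cy).
have two0 : 0 < 2 :> R by [].
have CS := C1L2_sech_pow th0 two0.
have LS := C1L2_Lsq CS.
have LSS : Lsq (S 2 * S 2) by apply: Lsq_sechM.
have S2y : inner (S 2) y = 0.
  have E0 := TSz; rewrite zE in E0; move: E0; inner_expand.
  have E1 := C1L2_ibp Cy (C1L2_tanh th0 CS); move: E1; inner_expand.
  rewrite (innerC _ y') (innerC y (S 2 * S 2)) -(inner_mull T y) (innerC (T * y)).
  rewrite innerZl; [|lsq|lsq]; rewrite inner_tanh_tanh// => -> E.
  by apply: (mulfI (lt0r_neq0 th0)); rewrite mulr0 -E; ring.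
have le12 : 1 <= 2 :> R by lra.
have := ladder_gap_ge1 le12 Cy S2y.
by rewrite zE (conj_norm 3 Cy) (ladder_norm 2 Cy); lra.
Qed.

Lemma inner_sech_pow a b c d : a + b = c + d -> inner (S a) (S b) = inner (S c) (S d).
Proof.
move=> abcd; congr Rintegral; apply/funext => x.
rewrite -[LHS]/((S a * S b) x) -[RHS]/((S c * S d) x).
by rewrite !sech_powD abcd.
Qed.

(** Recursion between the integrals of sech^4 and sech^6: [inner_tanh] at y = sech^2. *)
Lemma inner_sech46 : 4 * inner (S 2) (S 2) = 5 * inner (S 3) (S 3).
Proof.
have two0 : 0 < 2 :> R by [].
have CS := C1L2_sech_pow th0 two0; have LS := C1L2_Lsq CS.
have := inner_tanh CS; rewrite (innerZl _ (Lsq_tanh th LS) (Lsq_tanh th LS)).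
rewrite (inner_tanh_tanh LS LS) sech_powD (@inner_sech_pow (2 + 2) 2 3 3); last by ring.
move: (inner (S 2) (S 2)) (inner (S 3) (S 3)) => I4 I6 E.
by apply: (mulfI (lt0r_neq0 th0)); lra.
Qed.

Lemma inner_sech3_gt0 : 0 < inner (S 3) (S 3).
Proof.
have L3 : Lsq (S 3) by apply: Lsq_sech_pow.
rewrite lt_neqAle inner_ge0 andbT eq_sym; apply/eqP.
move=> /(inner_eq0 (@continuous_sech_pow _ th 3) L3) /(congr1 (@^~ 0)) S0.
by have := sech_pow_gt0 th 3 0; rewrite S0 ltxx.
Qed.

Lemma inner_sech23_ge : inner (S 3) (S 3) <= inner (S 2) (S 3).
Proof.
have L2 : Lsq (S 2) by apply: Lsq_sech_pow.
have L3 : Lsq (S 3) by apply: Lsq_sech_pow.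
apply: inner_le => // x; rewrite ler_wpM2r ?(ltW (sech_pow_gt0 _ _ _))//.
have -> : (3 : R) = 2 + 1 by ring.
rewrite -sech_powD -[leRHS]mulr1 ler_wpM2l ?(ltW (sech_pow_gt0 _ _ _))//.
by apply: sech_pow_le1.
Qed.

(** The two lowest eigenfunctions of B_3^* B_3 are orthogonal: up to a factor the integrand is the
    derivative of sech^5. *)
Lemma inner_tanh_sech23 : inner (T * S 2) (S 3) = 0.
Proof.
have two0 : 0 < 2 :> R by []; have three0 : 0 < 3 :> R by [].
have C2 := C1L2_sech_pow th0 two0; have C3 := C1L2_sech_pow th0 three0.
have L2 := C1L2_Lsq C2; have L3 := C1L2_Lsq C3.
have := C1L2_ibp C2 C3; inner_expand; rewrite -(inner_mull T) => E.
by apply: (mulfI (lt0r_neq0 th0)); lra.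
Qed.

(* The Rayleigh quotient of sech^2 against the ground state sech^3 is close
   enough to optimal for the constraint w _|_ sech^2 to remove the only
   negative direction of -d^2 + 4 th^2 - 12 th^2 sech^2. *)
Lemma soliton_coercive w w' : C1L2 w w' -> inner (T * S 2) w = 0 ->
  th ^+ 2 * (inner w w / 3 - 11 * inner (S 2) w ^+ 2 / inner (S 3) (S 3)) <=
  inner w' w' + 4 * th ^+ 2 * inner w w - 12 * th ^+ 2 * inner (S 2 * w) w.
Proof.
move=> Cw TSw; have three0 : 0 < 3 :> R by [].
have C3 := C1L2_sech_pow th0 three0.
have L2 : Lsq (S 2) by apply: Lsq_sech_pow.
have L3 := C1L2_Lsq C3; have [Lw Lw'] := (C1L2_Lsq Cw, C1L2_Lsq' Cw).
have I60 := inner_sech3_gt0; have I46 := inner_sech46; have I56 := inner_sech23_ge.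
pose a := inner (S 3) w / inner (S 3) (S 3).
have aE : a * inner (S 3) (S 3) = inner (S 3) w by rewrite /a (divfK (lt0r_neq0 I60)).
have Cr := C1L2B Cw (C1L2Z a C3).
have S3r : inner (S 3) (w - a *: S 3) = 0 by inner_expand; rewrite aE subrr.
have TSr : inner (T * S 2) (w - a *: S 3) = 0.
  by inner_expand; rewrite TSw inner_tanh_sech23 mulr0 subrr.
have := ladder3_gap Cr S3r TSr.
have -> : 'B_3(w - a *: S 3, w' - a *: (- (3 * th) *: (T * S 3))) = 'B_3(w, w').
  apply/funext => x.
  rewrite -[LHS]/(w' x - a * (- (3 * th) * (T x * S 3 x)) +
    3 * th * (T x * (w x - a * S 3 x))).
  rewrite -[RHS]/(w' x + 3 * th * (T x * w x)); ring.
rewrite (ladder_norm 3 Cw).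
have Lr := C1L2_Lsq Cr; move: S3r Lr.
have [r rE] : exists r, r = w - a *: S 3 by eexists.
rewrite -rE => S3r Lr gap.
have wE : inner w w = a ^+ 2 * inner (S 3) (S 3) + inner r r.
  by rewrite rE; inner_expand; rewrite (innerC w (S 3)) -aE; ring.
pose i5 := inner (S 2) (S 3) / inner (S 3) (S 3).
have i5E : i5 * inner (S 3) (S 3) = inner (S 2) (S 3) by rewrite /i5 (divfK (lt0r_neq0 I60)).
(* The part of sech^2 orthogonal to the ground state. Its squared norm is at most I6 / 4: I4 = 5 I6
   / 4, and the projection has squared norm at least I6. *)
pose psi : R -> R := S 2 - i5 *: S 3.
have Lpsi : Lsq psi by rewrite /psi; lsq.
have sE : inner (S 2) w = a * inner (S 2) (S 3) + inner psi r.
  have -> : inner psi r = inner (S 2) r.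
    by rewrite /psi; inner_expand; rewrite S3r mulr0 subr0.
  by rewrite rE; inner_expand; ring.
have psiE : inner psi psi = inner (S 2) (S 2) - i5 ^+ 2 * inner (S 3) (S 3).
  rewrite /psi; inner_expand; rewrite (innerC (S 3) (S 2)) -i5E.
  by move: (inner (S 2) (S 2)) (inner (S 3) (S 3)) => I4 I6; ring.
have CS := inner_CS Lpsi Lr.
rewrite -subr_ge0.
clearbody a i5; have r0 := inner_ge0 r; have w0 := inner_ge0 w.
move: wE sE psiE CS r0 w0 gap I60 I46 I56 i5E.
move: (inner (S 3) (S 3)) (inner (S 2) (S 3)) (inner (S 2) (S 2)) => I6 I5 I4.
move: (inner w w) (inner r r) (inner psi psi) (inner psi r) (inner (S 2) w) => W N P q s.
move: (inner w' w') (inner (S 2 * w) w) => W' X.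
move=> WE sE PE CS N0 W0 gap I60 I46 I56 i5E.
have i51 : 1 <= i5 by rewrite -(ler_pM2r I60) mul1r i5E.
have P4 : P <= I6 / 4.
  rewrite PE; have : 1 * I6 <= i5 ^+ 2 * I6.
    by rewrite ler_pM2r// expr_ge1// (le_trans _ i51).
  by move: I46; move: (i5 ^+ 2 * I6) => v; lra.
have u0 : 0 <= s ^+ 2 / I6 by rewrite divr_ge0 ?sqr_ge0// ltW.
set u := s ^+ 2 / I6 in u0 *.
(* The ground-state part of w is controlled by s = <sech^2, w> and r: a I5 = s - q with q^2 <= I6 N
   / 4, and I5 >= I6. *)
have t_le : a ^+ 2 * I6 <= 2 * u + N / 2.
  rewrite -(ler_pM2r I60) mulrDl -[2 * u * I6]mulrA /u divfK ?lt0r_neq0//.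
  have q2 : q ^+ 2 <= I6 / 4 * N by apply: le_trans CS _; rewrite ler_wpM2r.
  apply: (@le_trans _ _ ((a * I5) ^+ 2)).
    rewrite exprMn -mulrA; apply: ler_wpM2l; first exact: sqr_ge0.
    by rewrite expr2; apply: ler_pM => //; exact: ltW.
  have -> : a * I5 = s - q by rewrite sE addrK.
  have : (s - q) ^+ 2 <= 2 * s ^+ 2 + 2 * q ^+ 2.
    by rewrite -subr_ge0 (_ : _ - _ = (s + q) ^+ 2) ?sqr_ge0//; ring.
  by move=> /le_trans; apply; lra.
(* With t = a^2 I6 and W = t + N the bracket is 8 N / 3 - 16 t / 3 + 11 u. The bound on t uses up
   all of 8 N / 3 and costs 32 u / 3 <= 11 u; hence the constants 1/3 and 11. *)
have : 0 <= th ^+ 2 * (8 * N - 5 * W - W / 3 + 11 * u).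
  rewrite mulr_ge0 ?sqr_ge0//; move: t_le; rewrite WE.
  by move: (a ^+ 2 * I6) => t; lra.
have -> : 11 * s ^+ 2 / I6 = 11 * u by rewrite /u mulrA.
by lra.
Qed.

End SpectralGaps.

(** * Weak derivatives *)

Section WeakDerivatives.
Context {R : realType}.
Local Notation mu := (@lebesgue_measure R).
Implicit Types (f g h : R -> R) (a b : R).

Lemma Lsq_integrable_compact g (K : set R) : compact K -> Lsq g ->
  mu.-integrable K (EFin \o g).
Proof.
move=> cK Lg; have mK : measurable (K : set (measurableTypeR R)) := compact_measurable cK.
have mg := Lsq_measurable Lg.
have I1 : mu.-integrable K (EFin \o cst 1).
  apply: continuous_compact_integrable => //; apply: continuous_subspaceT => x.
  exact: cvg_cst.
have I2 : mu.-integrable K (EFin \o (g * g)).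
  by apply: integrableS (Lsq_integrableM Lg Lg).
have I3 := integrableD mK I1 I2; move: I3; apply: (le_integrable mK).
  by apply/measurable_EFinP; exact: measurable_funTS.
move=> x _ /=; rewrite lee_fin -[(g * g) x]/(g x * g x).
have gg : 0 <= g x * g x by rewrite -expr2 sqr_ge0.
rewrite [leRHS]ger0_norm ?addr_ge0// ler_norml.
have := sqr_ge0 (g x - 1); have := sqr_ge0 (g x + 1).
rewrite !expr2; nra.
Qed.

Lemma Lsq_integrable_itv g a b : Lsq g -> mu.-integrable `[a, b] (EFin \o g).
Proof. exact/Lsq_integrable_compact/segment_compact. Qed.

(** The difference has zero integral over every interval, so its primitive is constant, and Lebesgue
    differentiation makes it vanish almost everywhere. *)
Lemma wderiv_unique f g1 g2 : is_wderiv f g1 -> is_wderiv f g2 ->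
  {ae mu, forall x, g1 x = g2 x}.
Proof.
move=> [L1 E1] [L2 E2]; pose d := g1 - g2.
have Ld : Lsq d by exact: LsqB.
have loc : locally_integrable setT d.
  split; [exact: Lsq_measurable|exact: openT|move=> K _ cK].
  have /integrableP[_] := Lsq_integrable_compact cK Ld.
  by [].
have := lebesgue_differentiation loc; apply: ae_sub => x lx.
have xx : x < x + 1 by rewrite ltrDl.
have x1x : x - 1 < x by rewrite ltrBlDr ltrDl.
have [|dF FE] := @FTC1_lebesgue_pt R d (BLeft (x - 1)) x (x + 1) xx
  (Lsq_integrable_itv _ _ Ld) _ lx.
  by rewrite lte_fin.
apply/eqP; rewrite -subr_eq0; apply/eqP; rewrite -[LHS]/(d x) -FE.
rewrite (_ : (fun y => _) = cst 0); first by rewrite derive1_cst.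
apply/funext => y /=; have [ay|ya] := leP (x - 1) y.
  rewrite RintegralB//; [|exact: Lsq_integrable_itv..].
  by rewrite -E1// -E2// subrr.
by rewrite set_itv_ge ?Rintegral_set0// bnd_simp -ltNge.
Qed.

Lemma wderiv_spec f : H1 f -> is_wderiv f (wderiv f).
Proof. by move=> [_ [g fg]]; exact: (xgetPex _ (ex_intro _ g fg)). Qed.

Lemma is_derive_wderiv f g h : is_wderiv f g -> continuous h ->
  {ae mu, forall x, g x = h x} -> forall x : R, is_derive x 1 f (h x).
Proof.
move=> [Lg fE] ch gh x; pose F (y : R) := \int[mu]_(t in `[x - 1, y]) h t.
have xx : x < x + 1 by rewrite ltrDl.
have x1x : x - 1 < x by rewrite ltrBlDr ltrDl.
have [dF FE] := continuous_FTC1_closed xx (continuous_int_itv _ _ ch) x1x (ch x).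
have dFx : is_derive x 1 F (h x) by split; [exact: dF|rewrite -derive1E; exact: FE].
apply: (@near_eq_is_derive _ _ _ (cst (f (x - 1)) + F)).
  near=> y; have ay : x - 1 <= y by near: y; exact: lt_le_nbhsr.
  rewrite -[LHS]/(f (x - 1) + F y) /F.
  have -> : \int[mu]_(t in `[x - 1, y]) h t = \int[mu]_(t in `[x - 1, y]) g t.
    congr fine; apply: ae_eq_integral => //.
    - apply/measurable_EFinP; apply: measurable_funTS.
      exact: continuous_measurable_fun.
    - apply/measurable_EFinP; apply: measurable_funTS.
      exact: Lsq_measurable.
    - by apply: ae_sub gh => t /= ->.
  by rewrite -fE// addrC subrK.
by apply: (is_derive_eq (is_deriveD (is_derive_cst _ _ _) dFx)); rewrite add0r.
Unshelve. all: by end_near. Qed.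

(** Regularity bootstrap: once an equation identifies [D2 f] almost everywhere with a continuous
    function, f is of class C^2. *)
Lemma H2_C1L2 f h : H2 f -> continuous h -> {ae mu, forall x, D2 f x = h x} ->
  C1L2 f (derive1 f) /\ C1L2 (derive1 f) h.
Proof.
move=> [Lf df H1f] ch fh.
have wf := wderiv_spec H1f; have d1 := is_derive_wderiv wf ch fh.
have Lh : Lsq h.
  apply: (@Lsq_ae _ h (D2 f)); last by case: wf.
    exact: continuous_measurable_fun.
  by apply: ae_sub fh => x ->.
case: (H1f) => Lf' _; split.
  by split; [move=> x; split; [exact: df|rewrite -derive1E]|
    exact: is_derive_continuous d1|exact: Lf|exact: Lf'].
by split; [exact: d1|exact: ch|exact: Lf'|exact: Lh].
Qed.

Lemma derive1_ext f f' : (forall x : R, is_derive x 1 f (f' x)) -> derive1 f = f'.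
Proof. by move=> df; apply/funext => x; rewrite derive1E derive_val. Qed.

(** The way back, which puts the symmetry vectors into the domain of the Hessian. *)
Lemma C1L2_H2 f f' f'' : C1L2 f f' -> C1L2 f' f'' ->
  [/\ H2 f, derive1 f = f' & {ae mu, forall x, D2 f x = f'' x}].
Proof.
move=> [df _ Lf _] [df' cf'' Lf' Lf''].
have fE := derive1_ext df.
have wf : is_wderiv f' f''.
  by split => // a b ab; rewrite (Rintegral_derive df').
have H1f : H1 f' by split => //; exists f''.
split => //.
  by split => //; rewrite fE.
by rewrite /D2 fE; apply: wderiv_unique wf; exact: wderiv_spec.
Qed.

Lemma C1L2_normH2 f f' : (forall x : R, is_derive x 1 f (f' x)) ->
  inner f f + inner f' f' <= normH2 f ^+ 2.
Proof.
move=> df; have fE := derive1_ext df.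
rewrite sqr_sqrtr; last by rewrite !addr_ge0 ?inner_ge0.
by rewrite fE lerDl inner_ge0.
Qed.

End WeakDerivatives.

(** * Perturbation of the soliton *)

Section Perturbation.
Context {R : realType}.
Variable th : R.
Hypothesis th0 : 0 < th.
Local Notation T := (tanh_sc th).
Local Notation S := (sech_pow th).
Local Notation "''B_' p ( z , z' )" := (z' + (p * th) *: (T * z))
  (at level 8, p at level 2).
Implicit Types (f g h z w A U : R -> R) (e : R).

Lemma inner_weight_le h h0 f e : (forall x, `|h x - h0 x| <= e) ->
  Lsq f -> Lsq (h * f) -> Lsq (h0 * f) ->
  inner (h * f) f <= inner (h0 * f) f + e * inner f f.
Proof.
move=> he Lf Lhf Lh0f.
have -> : inner (h0 * f) f + e * inner f f = inner (h0 * f + e *: f) f by inner_expand.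
apply: inner_le => // [|x]; first lsq.
rewrite -[leLHS]/(h x * f x * f x) -[leRHS]/((h0 x * f x + e * f x) * f x) -!mulrDl -!mulrA.
rewrite ler_wpM2r -?expr2 ?sqr_ge0//.
by have := he x; rewrite ler_norml => /andP[_]; lra.
Qed.

(* If the form is coercive off g and almost vanishes on A, then A is almost
   proportional to g and the form is coercive off A. *)
Lemma ladder_coercive_perp p b z z' A A' : 0 < p -> 0 < b ->
  (forall f f', C1L2 f f' -> inner (S p) f = 0 ->
    b * inner f f <= inner 'B_p(f, f') 'B_p(f, f')) ->
  C1L2 z z' -> C1L2 A A' -> 0 < inner A A -> inner A z = 0 ->
  inner 'B_p(A, A') 'B_p(A, A') <= b / 4 * inner A A ->
  3 / 4 * b * inner z z <= inner 'B_p(z, z') 'B_p(z, z').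
Proof.
move=> p0 b0 gap Cz CA A0 Az BA.
have Cg := C1L2_sech_pow th0 p0; have Lg := C1L2_Lsq Cg.
have G0 : 0 < inner (S p) (S p).
  rewrite lt_neqAle inner_ge0 andbT eq_sym; apply/eqP.
  move=> /(inner_eq0 (@continuous_sech_pow _ th p) Lg) /(congr1 (@^~ 0)) S0.
  by have := sech_pow_gt0 th p 0; rewrite S0 ltxx.
have split f f' : C1L2 f f' -> exists a r, [/\ f = a *: S p + r, Lsq r, inner (S p) r = 0 &
    b * inner r r <= inner 'B_p(f, f') 'B_p(f, f')].
  move=> Cf; have Lf := C1L2_Lsq Cf.
  pose a := inner (S p) f / inner (S p) (S p).
  have aE : a * inner (S p) (S p) = inner (S p) f by rewrite /a divfK// lt0r_neq0.
  have Cr := C1L2B Cf (C1L2Z a Cg).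
  have S3r : inner (S p) (f - a *: S p) = 0 by inner_expand; rewrite aE subrr.
  exists a, (f - a *: S p); split => //.
  - by rewrite addrC subrK.
  - exact: C1L2_Lsq Cr.
  - have := gap _ _ Cr S3r.
    have -> // : 'B_p(f - a *: S p, f' - a *: (- (p * th) *: (T * S p))) = 'B_p(f, f').
    apply/funext => x.
    rewrite -[LHS]/(f' x - a * (- (p * th) * (T x * S p x)) +
      p * th * (T x * (f x - a * S p x))).
    by rewrite -[RHS]/(f' x + p * th * (T x * f x)); ring.
have [a [r [AE Lr Sr gr]]] := split _ _ CA.
have [d [y [zE Ly Sy gy]]] := split _ _ Cz.
apply: le_trans gy; move: gr => /le_trans /(_ BA) gr.
have CS := inner_CS Lr Ly.
have AAE : inner A A = a ^+ 2 * inner (S p) (S p) + inner r r.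
  by rewrite AE; inner_expand; rewrite (innerC r (S p)) Sr; ring.
have zzE : inner z z = d ^+ 2 * inner (S p) (S p) + inner y y.
  by rewrite zE; inner_expand; rewrite (innerC y (S p)) Sy; ring.
have AzE : a * d * inner (S p) (S p) + inner r y = 0.
  by rewrite -Az AE zE; inner_expand; rewrite (innerC r (S p)) Sr Sy; ring.
have y0 := inner_ge0 y; have r0 := inner_ge0 r.
move: A0 G0 gr CS AAE zzE AzE y0 r0; rewrite -mulrA.
move: (inner A A) (inner z z) (inner r r) (inner y y) (inner r y) (inner (S p) (S p)).
move=> AA zz rr yy ry G A0 G0 gr CS AAE zzE AzE y0 r0.
(* At most a quarter of |A|^2 lies off the kernel direction, so the part along it, a^2 G, is at
   least 3 rr. *)
have rr4 : rr <= AA / 4 by rewrite -(ler_pM2l b0); lra.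
have aG : 3 * rr <= a ^+ 2 * G by lra.
have aG0 : 0 < a ^+ 2 * G by lra.
(* Orthogonality of A and z reads a d G = - ry; Cauchy-Schwarz then bounds the kernel part of z by
   yy / 3, so |z|^2 <= 4 yy / 3. *)
have key : d ^+ 2 * G <= yy / 3.
  rewrite -(ler_pM2r aG0).
  have -> : d ^+ 2 * G * (a ^+ 2 * G) = ry ^+ 2.
    have -> : ry = - (a * d * G) by lra.
    by ring.
  apply: le_trans CS _; rewrite mulrC mulrAC -mulrA; apply: ler_wpM2l => //.
  by lra.
have zy : 3 / 4 * zz <= yy by rewrite zzE; lra.
by have := ler_wpM2l (ltW b0) zy; lra.
Qed.

Lemma inner_cross_le A w z e : measurable_fun setT A -> (forall x, `|A x| <= e) ->
  Lsq w -> Lsq z -> 4 * inner (A * w) z <= 2 * e * (inner w w + inner z z).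
Proof.
move=> mA Ae Lw Lz; have LAw : Lsq (A * w) by exact: LsqM mA Ae Lw.
have e0 : 0 <= e := le_trans (normr_ge0 _) (Ae 0).
have AAw : inner (A * w) (A * w) <= e ^+ 2 * inner w w.
  rewrite -innerZl//; apply: inner_le => // [|x]; first lsq.
  rewrite -[leLHS]/((A x * w x) * (A x * w x)) -[leRHS]/(e ^+ 2 * w x * w x).
  rewrite -expr2 exprMn -mulrA -expr2 ler_wpM2r ?sqr_ge0//.
  by rewrite -(@real_normK _ (A x)) ?num_real// lerXn2r ?nnegrE.
have := inner_CS LAw Lz; move: AAw (inner_ge0 w) (inner_ge0 z).
move: (inner w w) (inner z z) (inner (A * w) z) (inner (A * w) _) => a b X Y Y_le a0 b0 XY.
have X2 : X ^+ 2 <= e ^+ 2 * a * b by apply: le_trans XY _; rewrite ler_wpM2r.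
have ab0 : 0 <= e * (a + b) by rewrite mulr_ge0// addr_ge0.
have : (2 * X) ^+ 2 <= (e * (a + b)) ^+ 2.
  have := mulr_ge0 (sqr_ge0 e) (sqr_ge0 (a - b)).
  by rewrite !exprMn => h; rewrite -subr_ge0; move: h X2; lra.
rewrite -(@real_normK _ (2 * X)) ?num_real// => h.
have : `|2 * X| <= e * (a + b).
  by move: h; rewrite ler_pXn2r ?nnegrE.
by move=> /(le_trans (ler_norm _)); lra.
Qed.

Lemma inner_tanh_sech_gt0 : 0 < inner (T * S 2) (T * S 2).
Proof.
have L : Lsq (T * S 2) by apply/(Lsq_tanh th)/Lsq_sech_pow.
rewrite lt_neqAle inner_ge0 andbT eq_sym; apply/eqP.
have c : continuous (T * S 2).
  by move=> x; apply: cvgM; [exact: continuous_tanh_sc|exact: continuous_sech_pow].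
move=> /(inner_eq0 c L) /(congr1 (@^~ 1)) /eqP.
rewrite -[X in X == _]/(T 1 * S 2 1) mulf_eq0.
by rewrite !gt_eqF ?sech_pow_gt0 ?tanh_sc_gt0.
Qed.

(* 12 th^2 sech^2 is U0 for c = 4 th^2, and - 24 th^3 tanh sech^2 is its derivative. *)
Definition near_soliton e k p Om (U U' A A' : R -> R) : Prop :=
  [/\ C1L2 U U' /\ C1L2 A A',
      (forall x, `|U x - 12 * th ^+ 2 * S 2 x| <= e) /\ (forall x, `|A x| <= e),
      `|Om + (p * th) ^+ 2| <= e,
      inner (U - (12 * th ^+ 2) *: S 2) (U - (12 * th ^+ 2) *: S 2) <= e ^+ 2 /\
      inner (U' - (- (24 * th ^+ 3)) *: (T * S 2)) (U' - (- (24 * th ^+ 3)) *: (T * S 2))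
        <= e ^+ 2 &
      0 < inner A A /\ inner A' A' - Om * inner A A - k * inner (U * A) A = 0].

Lemma near_soliton_Lsq e k p Om U U' A A' f : near_soliton e k p Om U U' A A' ->
  Lsq f -> Lsq (U * f) /\ Lsq (A * f).
Proof.
move=> [[CU CA] [Ue Ae] _ _ _] Lf; split.
  apply: (@LsqM _ U f (e + 12 * th ^+ 2)) => //.
    by apply: continuous_measurable_fun; exact: C1L2_continuous CU.
  move=> x; have -> : U x = (U x - 12 * th ^+ 2 * S 2 x) + 12 * th ^+ 2 * S 2 x.
    by rewrite subrK.
  apply: le_trans (ler_normD _ _) _; apply: lerD => //.
  have t0 : 0 <= 12 * th ^+ 2 by rewrite mulr_ge0// sqr_ge0.
  by rewrite normrM (ger0_norm t0) -[leRHS]mulr1 ler_wpM2l// normr_sech_pow.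
apply: (LsqM _ Ae) => //.
by apply: continuous_measurable_fun; exact: C1L2_continuous CA.
Qed.

(** The relation p (p + 1) = 12 k identifies B_p^* B_p with L_g, whose constant term is (p th)^2 and
    whose potential is k U0. What remains is an error e from Om and k e from U. *)
Lemma near_soliton_modes e k p Om U U' A A' f f' : 0 < k -> p * (p + 1) = 12 * k ->
  near_soliton e k p Om U U' A A' -> C1L2 f f' ->
  `|inner f' f' - Om * inner f f - k * inner (U * f) f - inner 'B_p(f, f') 'B_p(f, f')|
    <= (1 + k) * e * inner f f.
Proof.
move=> k0 pk ns Cf; have Lf := C1L2_Lsq Cf.
have [LU _] := near_soliton_Lsq ns Lf.
case: ns => _ [Ue _] Ome _ _.
have L2 : Lsq (((12 * th ^+ 2) *: S 2) * f).
  have -> : ((12 * th ^+ 2) *: S 2) * f = (12 * th ^+ 2) *: (S 2 * f).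
    by apply/funext => x; exact: esym (mulrA _ _ _).
  by apply: LsqZ; exact: Lsq_sechM.
have E2 : inner (((12 * th ^+ 2) *: S 2) * f) f = 12 * th ^+ 2 * inner (S 2 * f) f.
  have -> : ((12 * th ^+ 2) *: S 2) * f = (12 * th ^+ 2) *: (S 2 * f).
    by apply/funext => x; exact: esym (mulrA _ _ _).
  by rewrite innerZl//; exact: Lsq_sechM.
have := inner_weight_le Ue Lf LU L2.
have Ue' x : `|((12 * th ^+ 2) *: S 2) x - U x| <= e by rewrite distrC; exact: Ue.
have := inner_weight_le Ue' Lf L2 LU.
rewrite E2 (ladder_norm th0 p Cf) pk => h1 h2.
have f0 := inner_ge0 f.
have k1 := ler_wpM2l (ltW k0) h1; have k2 := ler_wpM2l (ltW k0) h2.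
move: Ome; rewrite !ler_norml => /andP[lo hi].
have b1 := ler_wpM2r f0 lo.
have b2 := ler_wpM2r f0 hi.
by apply/andP; split; lra.
Qed.

End Perturbation.

(** * Coercivity of the Hessian form near the bifurcation point *)

Section Coercivity.
Context {R : realType}.
Variables th k p : R.
Hypotheses (th0 : 0 < th) (k0 : 0 < k) (p0 : 0 < p) (pk : p * (p + 1) = 12 * k).
Local Notation T := (tanh_sc th).
Local Notation S := (sech_pow th).
Implicit Types (f g h z w A U : R -> R) (e : R).

(* Here 4 th^2 is the wave speed c. *)
Definition hessian_form Om U A (w w' z1 z1' z2 z2' : R -> R) : R :=
  inner w' w' + 4 * th ^+ 2 * inner w w - inner (U * w) w - 4 * inner (A * w) z1
  + 2 / k * (inner z1' z1' - Om * inner z1 z1 - k * inner (U * z1) z1)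
  + 2 / k * (inner z2' z2' - Om * inner z2 z2 - k * inner (U * z2) z2).

(** Orthogonality of w to tanh sech^2, which is proportional to U0', and of z2 to A are not
    constraints: they fix the translational and rotational components. The first conjunct ensures
    that a multiple of U' can achieve the former. *)
Lemma hessian_form_coercive : exists2 e, 0 < e &
  forall Om U U' A A', near_soliton th e k p Om U U' A A' ->
  inner (T * S 2) U' != 0 /\
  forall w w' z1 z1' z2 z2' : R -> R, C1L2 w w' -> C1L2 z1 z1' -> C1L2 z2 z2' ->
  inner (T * S 2) w = 0 -> inner U w = 0 -> inner A z1 = 0 -> inner A z2 = 0 ->
  hessian_form Om U A w w' z1 z1' z2 z2' <= 0 ->
  [/\ inner w w = 0, inner z1 z1 = 0 & inner z2 z2 = 0].
Proof.
have [b b0 gap] := ladder_gap_gt0 th0 p0.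
have I60 := inner_sech3_gt0 th0; have TS0 := inner_tanh_sech_gt0 th0.
set I6 := inner (S 3) (S 3) in I60; set TS := inner (T * S 2) (T * S 2) in TS0.
have th20 : 0 < th ^+ 2 by rewrite exprn_gt0.
have kk0 : 0 < 1 + k by rewrite addr_gt0.
(* In order: 1 gives e^2 <= e; b / 4 / (1 + k) controls the error of the mode forms; b / 4 / k the
   z1 share of the cross term; th^2 / 24 the w share and the error of U; th^4 I6 the tilt of the
   constraint on w; the last keeps U' from being orthogonal to tanh sech^2. *)
pose e := Num.min 1 (Num.min (b / 4 / (1 + k)) (Num.min (b / 4 / k)
  (Num.min (th ^+ 2 / 24) (Num.min (th ^+ 4 * I6) ((24 * th ^+ 3) ^+ 2 * TS / 2))))).
have e0 : 0 < e.
  have ib (x y : R) : 0 < x -> 0 < y -> 0 < x / y by move=> ? ?; rewrite divr_gt0.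
  rewrite /e !lt_min ltr01 (ib _ _ (ib _ _ b0 _) kk0)// (ib _ _ (ib _ _ b0 _) k0)//.
  rewrite (ib _ _ th20)//= mulr_gt0 ?exprn_gt0//= divr_gt0// mulr_gt0// exprn_gt0//.
  by rewrite mulr_gt0// exprn_gt0.
have : e <= e by []; rewrite {2}/e !le_min => /andP[e1 /andP[e2 /andP[e3 /andP[e4 /andP[e5 e6]]]]].
have {}e2 : (1 + k) * e <= b / 4 by rewrite mulrC -ler_pdivlMr.
have {}e3 : k * e <= b / 4 by rewrite mulrC -ler_pdivlMr.
clearbody e; exists e => // Om U U' A A' ns.
have L2 : Lsq (S 2) by apply: Lsq_sech_pow.
have LTS : Lsq (T * S 2) by exact: Lsq_tanh.
have LU f : Lsq f -> Lsq (U * f) by move=> /(near_soliton_Lsq ns)[].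
have modes f f' := near_soliton_modes th0 k0 pk ns (f := f) (f' := f').
have [[CU CA] [Ue Ae] _ [UL UL'] [AA0 QA]] := ns.
have [LsU LsU'] := (C1L2_Lsq CU, C1L2_Lsq' CU).
have LsA := C1L2_Lsq CA.
have ee : e ^+ 2 <= e by rewrite expr2 -[leRHS]mul1r ler_wpM2r// ltW.
split.
  apply/eqP => TSU'.
  set c0 := - (24 * th ^+ 3) in UL'.
  have Ld : Lsq (U' - c0 *: (T * S 2)) by lsq.
  have := inner_CS Ld LTS.
  rewrite innerDl; [|lsq|lsq|lsq]; rewrite innerNl; [|lsq|lsq].
  rewrite innerZl; [|lsq|lsq]; rewrite (innerC U') TSU' add0r sqrrN exprMn.
  rewrite -/TS [TS ^+ 2]expr2 mulrA => h.
  have : c0 ^+ 2 * TS <= e ^+ 2.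
    rewrite -(ler_pM2r TS0); apply: le_trans h _.
    by rewrite ler_pM2r.
  rewrite /c0 sqrrN; move: e6 ee e0 => /=.
  by move: ((24 * th ^+ 3) ^+ 2 * TS) => N; lra.
move=> w w' z1 z1' z2 z2' Cw Cz1 Cz2 TSw Uw Az1 Az2.
have [Lw Lz1 Lz2] : [/\ Lsq w, Lsq z1 & Lsq z2].
  by split; [exact: C1L2_Lsq Cw|exact: C1L2_Lsq Cz1|exact: C1L2_Lsq Cz2].
(* The mode form of (U, Om) vanishes at A, so B_p A is small relative to A, however small A itself
   is. *)
have BA : inner (A' + (p * th) *: (T * A)) (A' + (p * th) *: (T * A)) <= b / 4 * inner A A.
  have := modes _ _ CA; rewrite QA sub0r normrN => /(le_trans (ler_norm _)).
  by move=> /le_trans; apply; rewrite ler_wpM2r// ltW.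
have mode z z' : C1L2 z z' -> inner A z = 0 ->
    b / 2 * inner z z <= inner z' z' - Om * inner z z - k * inner (U * z) z.
  move=> Cz Az; have h1 := ladder_coercive_perp th0 p0 b0 gap Cz CA AA0 Az BA.
  have := modes _ _ Cz; rewrite ler_norml => /andP[h2 _].
  have h3 := ler_wpM2r (inner_ge0 z) e2.
  move: h1 h2 h3; move: (inner z z) (inner z' z') (inner (U * z) z) (inner _ _).
  by move=> x y u v; clear - th0 k0 p0 pk x y u v; lra.
have Q1 := mode _ _ Cz1 Az1; have Q2 := mode _ _ Cz2 Az2.
have cross := inner_cross_le (Lsq_measurable LsA) Ae Lw Lz1.
have sol := soliton_coercive th0 Cw TSw.
have L0 : Lsq (((12 * th ^+ 2) *: S 2) * w).
  have -> : ((12 * th ^+ 2) *: S 2) * w = (12 * th ^+ 2) *: (S 2 * w).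
    by apply/funext => x; exact: esym (mulrA _ _ _).
  by apply: LsqZ; exact: Lsq_sechM.
have E0 : inner (((12 * th ^+ 2) *: S 2) * w) w = 12 * th ^+ 2 * inner (S 2 * w) w.
  have -> : ((12 * th ^+ 2) *: S 2) * w = (12 * th ^+ 2) *: (S 2 * w).
    by apply/funext => x; exact: esym (mulrA _ _ _).
  by rewrite innerZl//; exact: Lsq_sechM.
have Uw_le := inner_weight_le Ue Lw (LU _ Lw) L0; rewrite E0 in Uw_le.
(* As <U, w> = 0, the product of w with U0 equals its product with U0 - U, which is small. *)
have sig : (12 * th ^+ 2 * inner (S 2) w) ^+ 2 <= e ^+ 2 * inner w w.
  have Ld : Lsq (U - (12 * th ^+ 2) *: S 2) by lsq.
  have := inner_CS Ld Lw.
  rewrite innerDl; [|lsq|lsq|lsq]; rewrite Uw add0r innerNl; [|lsq|lsq].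
  rewrite innerZl; [|lsq|lsq]; rewrite sqrrN => /le_trans; apply.
  by rewrite ler_wpM2r// inner_ge0.
have s11 : 11 * inner (S 2) w ^+ 2 / I6 <= inner w w / 8.
  rewrite ler_pdivrMr//.
  have t40 : 0 < th ^+ 4 by rewrite exprn_gt0.
  have h : inner (S 2) w ^+ 2 * 144 <= I6 * inner w w.
    rewrite -(ler_pM2r t40).
    have -> : inner (S 2) w ^+ 2 * 144 * th ^+ 4 = (12 * th ^+ 2 * inner (S 2) w) ^+ 2.
      by ring.
    apply: le_trans sig _; rewrite [leRHS]mulrAC; apply: ler_wpM2r; first exact: inner_ge0.
    by rewrite mulrC; exact: le_trans ee e5.
  have := mulr_ge0 (ltW I60) (inner_ge0 w); move: h.
  by move: (I6) (inner (S 2) w) (inner w w) => x y z; clear - th0 k0 p0 pk x y z; lra.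
have W0 := inner_ge0 w; have Z10 := inner_ge0 z1; have Z20 := inner_ge0 z2.
(* 5/24 = 1/3 - 1/8: the constraint costs at most 11/144 < 1/8. *)
have solW : th ^+ 2 * (5 / 24 * inner w w) <=
    inner w' w' + 4 * th ^+ 2 * inner w w - 12 * th ^+ 2 * inner (S 2 * w) w.
  apply: le_trans sol; rewrite ler_pM2l//; move: s11; rewrite -/I6.
  by move: (11 * _ / I6) (inner w w) => x y; clear - th0 k0 p0 pk x y; lra.
have eW := ler_wpM2r W0 e4.
have eZ : 2 * e * inner z1 z1 <= 2 / k * (b / 4) * inner z1 z1.
  apply: ler_wpM2r => //.
  have -> : 2 * e = 2 / k * (k * e) by field; exact: lt0r_neq0.
  by rewrite ler_wpM2l// divr_ge0// ltW.
have k20 : 0 <= 2 / k by rewrite divr_ge0// ltW.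
have q1 := ler_wpM2l k20 Q1; have q2 := ler_wpM2l k20 Q2.
rewrite /hessian_form => form0.
have bk : 0 < 2 / k * b by rewrite mulr_gt0// divr_gt0.
move: cross Uw_le solW eW eZ q1 q2 form0 th20 bk W0 Z10 Z20; rewrite !mulrBr.
move: (inner w w) (inner z1 z1) (inner z2 z2) (inner w' w') (inner (A * w) z1)
  (inner (U * w) w) (inner (S 2 * w) w) => W Z1 Z2 W' AW UW SW.
move: (2 / k) (inner z1' z1') (inner z2' z2') (inner (U * z1) z1) (inner (U * z2) z2).
move=> kk Z1' Z2' UZ1 UZ2.
clear - th0 k0 p0 pk b e Om W Z1 Z2 W' AW UW SW kk Z1' Z2' UZ1 UZ2.
move=> cross Uw_le solW eW eZ q1 q2 form0 th20 bk W0 Z10 Z20.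
(* For w, 5/24 loses e from U and 2 e from the cross term, that is 3/24; the coefficient of z1 is
   halved by the cross term. *)
have total : th ^+ 2 * W / 12 + kk * b * Z1 / 4 + kk * b * Z2 / 2 <= 0 by lra.
have tW := mulr_ge0 (ltW th20) W0.
have bZ1 := mulr_ge0 (ltW bk) Z10; have bZ2 := mulr_ge0 (ltW bk) Z20.
split.
- by apply: (mulfI (lt0r_neq0 th20)); rewrite mulr0; lra.
- by apply: (mulfI (lt0r_neq0 bk)); rewrite mulr0; lra.
- by apply: (mulfI (lt0r_neq0 bk)); rewrite mulr0; lra.
Qed.

End Coercivity.

(** * Regularity of the branch profiles and their distance to the soliton *)

Section Profile.
Context {R : realType}.
Local Notation mu := (@lebesgue_measure R).
Implicit Types (f g h w z U A : R -> R) (e c k Om : R).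

Lemma C1L2_bounded f f' : C1L2 f f' -> exists M, forall x, `|f x| <= M.
Proof.
move=> Cf; exists (1 + 2 * (inner f f + inner f' f')) => x.
have := C1L2_sup x Cf; rewrite -real_normK ?num_real//.
by have := sqr_ge0 (`|f x| - 1); have := normr_ge0 (f x); nra.
Qed.

Lemma C1L2_mul f f' f'' g g' : C1L2 f f' -> C1L2 f' f'' -> C1L2 g g' ->
  C1L2 (f * g) (f' * g + f * g').
Proof.
move=> Cf Cf' Cg.
have [M fM] := C1L2_bounded Cf; have [N f'N] := C1L2_bounded Cf'.
case: Cf => df cf' _ _.
apply: (@C1L2M _ _ _ _ _ (Num.max M N)) => // x; rewrite le_max.
  by rewrite fM.
by rewrite f'N orbT.
Qed.

Lemma C1L2_LsqM f f' g : C1L2 f f' -> Lsq g -> Lsq (f * g).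
Proof.
move=> Cf Lg; have [M fM] := C1L2_bounded Cf; apply: (LsqM _ fM) => //.
by apply: continuous_measurable_fun; exact: C1L2_continuous Cf.
Qed.

Lemma H2_continuous f : H2 f -> continuous f.
Proof.
by move=> [_ df _] x; apply: differentiable_continuous; apply/derivable1_diffP.
Qed.

Lemma H2_Lsq f : H2 f -> Lsq f. Proof. by case. Qed.

Lemma H2_Lsq_D2 f : H2 f -> Lsq (D2 f).
Proof. by move=> [_ _ Hf]; case: (wderiv_spec Hf). Qed.

(** Existence of a Lagrange multiplier: the residual h - m U is orthogonal to U, hence admissible as
    a test function, hence orthogonal to h and to itself. If U has zero norm, Cauchy-Schwarz gives
    <U, h> = 0. *)
Lemma Lsq_multiplier U h : Lsq U -> Lsq h ->
  (forall x, Lsq x -> inner U x = 0 -> inner h x = 0) ->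
  exists m : R, {ae mu, forall x, h x = m * U x}.
Proof.
move=> LU Lh orth; pose m := inner U h / inner U U; exists m.
have Ld : Lsq (h - m *: U) by lsq.
have Ud : inner U (h - m *: U) = 0.
  inner_expand; have [U0|U0] := eqVneq (inner U U) 0.
    rewrite U0 mulr0 subr0; apply/eqP; rewrite -sqrf_eq0 eq_le sqr_ge0 andbT.
    by have := inner_CS LU Lh; rewrite U0 mul0r.
  by rewrite /m divfK// subrr.
have := orth _ Ld Ud => hd.
have : inner (h - m *: U) (h - m *: U) = 0.
  rewrite innerDl; [|lsq|lsq|lsq]; rewrite hd innerNl; [|lsq|lsq].
  by rewrite innerZl; [|lsq|lsq]; rewrite Ud mulr0 oppr0 addr0.
move=> /(inner_eq0_ae Ld); apply: ae_sub => x.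
by rewrite -[(h - m *: U) x]/(h x - m * U x) => /eqP; rewrite subr_eq0 => /eqP.
Qed.

Lemma D2_continuous_rhs f h : H2 f -> continuous h ->
  {ae mu, forall x, D2 f x - h x = 0} ->
  C1L2 f (derive1 f) /\ C1L2 (derive1 f) h.
Proof.
move=> Hf ch fh; apply: H2_C1L2 => //.
by apply: ae_sub fh => x /eqP; rewrite subr_eq0 => /eqP.
Qed.

Lemma profile_C1L2 c k C Om U A : branch_profile c k 1 C Om U A ->
  (C1L2 U (derive1 U) /\ C1L2 (derive1 U) (c *: U - 2^-1 *: (U * U) - A * A)) /\
  (C1L2 A (derive1 A) /\ C1L2 (derive1 A) (- Om *: A - k *: (U * A))).
Proof.
move=> [_ [HU HA _ _ _] eU eA _].
have cU := H2_continuous HU; have cA := H2_continuous HA.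
have cM f g : continuous f -> continuous g -> continuous (f * g).
  by move=> cf cg x; apply: cvgM; [exact: cf|exact: cg].
have cZ a f : continuous f -> continuous (a *: f).
  by move=> cf x; apply: cvgZr; exact: cf.
have cB f g : continuous f -> continuous g -> continuous (f - g).
  by move=> cf cg x; apply: cvgB; [exact: cf|exact: cg].
split; apply: D2_continuous_rhs => //.
- by apply: (cB); [apply: (cB); [exact: cZ|apply: (cZ); exact: cM]|exact: cM].
- apply: ae_sub eU => x <-.
  rewrite -[(_ - A * A) x]/(c * U x - 2^-1 * (U x * U x) - A x * A x).
  by field.
- by apply: (cB); [exact: cZ|apply: (cZ); exact: cM].
- apply: ae_sub eA => x <-.
  rewrite -[(_ - k *: (U * A)) x]/(- Om * A x - k * (U x * A x)); ring.
Qed.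

(** The equation of A tested with A. *)
Lemma mode_energy_eq0 k Om U U' A A' : C1L2 U U' -> C1L2 A A' ->
  C1L2 A' (- Om *: A - k *: (U * A)) ->
  inner A' A' - Om * inner A A - k * inner (U * A) A = 0.
Proof.
move=> CU CA CA'; have [LA LA'] := (C1L2_Lsq CA, C1L2_Lsq' CA).
have LUA : Lsq (U * A) by exact: C1L2_LsqM CU LA.
by have := C1L2_ibp CA' CA; inner_expand; lra.
Qed.

Lemma p_exp_gt0 k : 0 < k -> 0 < p_exp k.
Proof.
move=> k0; rewrite divr_gt0// subr_gt0 -{1}[1]sqrtr1 ltr_sqrt; lra.
Qed.

Lemma p_expE k : 0 < k -> p_exp k * (p_exp k + 1) = 12 * k.
Proof.
move=> k0; have : Num.sqrt (1 + 48 * k) ^+ 2 = 1 + 48 * k.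
  by rewrite sqr_sqrtr//; lra.
rewrite /p_exp; move: (Num.sqrt _) => s s2.
have -> : (s - 1) / 2 * ((s - 1) / 2 + 1) = (s ^+ 2 - 1) / 4 by field.
by rewrite s2; field.
Qed.

Lemma sqrt_half_sqr c : 0 < c -> 4 * (Num.sqrt c / 2) ^+ 2 = c.
Proof. by move=> c0; rewrite expr_div_n sqr_sqrtr ?ltW//; field. Qed.

Lemma Omega_cE c k : 0 < c -> Omega_c c k = - (p_exp k * (Num.sqrt c / 2)) ^+ 2.
Proof.
move=> c0; rewrite /Omega_c /p_exp -{1}(sqrt_half_sqr c0).
by move: (Num.sqrt c) (Num.sqrt _) => s t; field.
Qed.

Lemma U0E c : 0 < c -> U0 c = (12 * (Num.sqrt c / 2) ^+ 2) *: sech_pow (Num.sqrt c / 2) 2.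
Proof.
move=> c0; apply/funext => x.
rewrite -[RHS]/(12 * (Num.sqrt c / 2) ^+ 2 * sech_pow (Num.sqrt c / 2) 2 x).
by rewrite sech_pow_nat /U0 -{1}(sqrt_half_sqr c0); ring.
Qed.

Lemma profile_near c k C e : 0 < c -> 0 < k -> 0 < e -> exists2 delta, 0 < delta &
  forall Om U A, `|Om - Omega_c c k| < delta -> branch_profile c k 1 C Om U A ->
  near_soliton (Num.sqrt c / 2) e k (p_exp k) Om U (derive1 U) A (derive1 A).
Proof.
move=> c0 k0 e0; set th := Num.sqrt c / 2.
have th0 : 0 < th by rewrite divr_gt0// sqrtr_gt0.
(* The 2 pays for the factor in [C1L2_sup]; the 1 keeps [D] positive when C = 0. Since t <= 1, both
   branch estimates take the common form C^2 t. *)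
pose D := 2 * C ^+ 2 + 1.
have D1 : 1 <= D by rewrite /D; have := sqr_ge0 C; lra.
have D0 : 0 < D by lra.
pose d := Num.min 1 (Num.min e (e ^+ 2 / D)).
have d0 : 0 < d by rewrite !lt_min ltr01 e0/= divr_gt0// exprn_gt0.
exists d => // Om U A; set t := `|_| => td bp.
have : t <= d by exact: ltW.
rewrite !le_min => /andP[t1 /andP[te tD]].
have t0 : 0 <= t by exact: normr_ge0.
have {}tD : t * D <= e ^+ 2 by rewrite -ler_pdivlMr.
have Ct : 2 * (C ^+ 2 * t) <= e ^+ 2 by move: tD; rewrite /D; lra.
have Ct1 : C ^+ 2 * t <= e ^+ 2.
  have h3 : 0 <= C ^+ 2 * t by rewrite mulr_ge0 ?sqr_ge0.
  by apply: le_trans Ct; rewrite ler_peMl// ler1n.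
have [[CU CU'] [CA CA']] := profile_C1L2 bp.
case: bp => _ [HU HA _ _ A0] _ eA [nU nA].
have two0 : 0 < 2 :> R by [].
have C0 : C1L2 (U0 c) ((- (24 * th ^+ 3)) *: (tanh_sc th * sech_pow th 2)).
  rewrite (U0E c0) -/th.
  have -> : - (24 * th ^+ 3) = 12 * th ^+ 2 * - (2 * th) by ring.
  by rewrite -(scalerA (12 * th ^+ 2)); apply: C1L2Z; exact: C1L2_sech_pow.
have Cd := C1L2B CU C0.
have normU : inner (U - U0 c) (U - U0 c) +
    inner (derive1 U - (- (24 * th ^+ 3)) *: (tanh_sc th * sech_pow th 2))
    (derive1 U - (- (24 * th ^+ 3)) *: (tanh_sc th * sech_pow th 2)) <= C ^+ 2 * t.
  case: (Cd) => dd _ _ _; apply: le_trans (C1L2_normH2 dd) _.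
  apply: (@le_trans _ _ ((C * t) ^+ 2)).
    by rewrite lerXn2r ?nnegrE ?sqrtr_ge0// (le_trans _ nU)// sqrtr_ge0.
  by rewrite exprMn ler_wpM2l ?sqr_ge0// expr2 -[leRHS]mul1r ler_wpM2r.
have normA : inner A A + inner (derive1 A) (derive1 A) <= C ^+ 2 * t.
  case: (CA) => dd _ _ _; apply: le_trans (C1L2_normH2 dd) _.
  apply: (@le_trans _ _ ((C * Num.sqrt t) ^+ 2)).
    by rewrite lerXn2r ?nnegrE ?sqrtr_ge0// (le_trans _ nA)// sqrtr_ge0.
  by rewrite exprMn sqr_sqrtr.
have sup f f' x : C1L2 f f' -> inner f f + inner f' f' <= C ^+ 2 * t -> `|f x| <= e.
  move=> Cf fC; have := C1L2_sup x Cf => fx.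
  rewrite -(@ler_pXn2r _ 2)// ?nnegrE ?(ltW e0)//.
  rewrite real_normK ?num_real//; apply: le_trans fx (le_trans _ Ct).
  by rewrite ler_pM2l.
split; first by [].
- split=> x; last exact: sup CA normA.
  have := sup _ _ x Cd normU; rewrite (U0E c0) -/th.
  by rewrite -[(U - _) x]/(U x - 12 * th ^+ 2 * sech_pow th 2 x).
- by move: te; rewrite /t (Omega_cE k c0) opprK.
- rewrite -(U0E c0); split; apply: le_trans Ct1; apply: le_trans normU.
    by rewrite lerDl inner_ge0.
  by rewrite lerDr inner_ge0.
- split; last exact: mode_energy_eq0 CU CA CA'.
  rewrite lt_neqAle inner_ge0 andbT eq_sym; apply/eqP.
  by move=> /(inner_eq0 (C1L2_continuous CA) (C1L2_Lsq CA)).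
Qed.

End Profile.

(** * The constrained Hessian *)

Section ConstrainedHessian.
Context {R : realType}.
Local Notation mu := (@lebesgue_measure R).
Variables c k Om : R.
Hypothesis k0 : 0 < k.
Variables U U' A A' : R -> R.
Local Notation U'' := (c *: U - 2^-1 *: (U * U) - A * A).
Local Notation A'' := (- Om *: A - k *: (U * A)).
Hypotheses (CU : C1L2 U U') (CU' : C1L2 U' U'').
Hypotheses (CA : C1L2 A A') (CA' : C1L2 A' A'').
Implicit Types (f g h w z u y : R -> R) (a b lam : R).

Let LsqU f : Lsq f -> Lsq (U * f). Proof. exact: C1L2_LsqM CU. Qed.
Let LsqA f : Lsq f -> Lsq (A * f). Proof. exact: C1L2_LsqM CA. Qed.

(** Weak form of the first row of the Hessian with right-hand side g, which will hold the eigenvalue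
    and multiplier terms. In [weak_mode], g also absorbs the coupling with w. *)
Lemma weak_wave w w' z g u u' : C1L2 w w' -> Lsq z -> Lsq g -> C1L2 u u' ->
  C1L2 w' (c *: w - U * w - 2 *: (A * z) - g) ->
  inner w' u' + c * inner w u - inner (U * w) u - 2 * inner (A * z) u = inner g u.
Proof.
move=> Cw Lz Lg Cu Cw'; have [Lw Lu] := (C1L2_Lsq Cw, C1L2_Lsq Cu).
by have := C1L2_ibp Cw' Cu; inner_expand; lra.
Qed.

Lemma weak_mode z z' g y y' : C1L2 z z' -> Lsq g -> C1L2 y y' ->
  C1L2 z' (- Om *: z - k *: (U * z) - (k / 2) *: g) ->
  2 / k * (inner z' y' - Om * inner z y - k * inner (U * z) y) = inner g y.
Proof.
move=> Cz Lg Cy Cz'; have [Lz Ly] := (C1L2_Lsq Cz, C1L2_Lsq Cy).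
have := C1L2_ibp Cz' Cy; inner_expand => E.
have -> : inner z' y' = Om * inner z y + k * inner (U * z) y + k / 2 * inner g y by lra.
by field; exact: lt0r_neq0.
Qed.

(** Translation invariance: differentiating the equation of U shows that (U', A', 0) solves the
    first row of the linearized system. *)
Lemma C1L2_U'' : C1L2 U'' (c *: U' - U * U' - 2 *: (A * A')).
Proof.
have -> : c *: U' - U * U' - 2 *: (A * A') =
    c *: U' - 2^-1 *: (U' * U + U * U') - (A' * A + A * A').
  apply/funext => x.
  rewrite -[LHS]/(c * U' x - U x * U' x - 2 * (A x * A' x)).
  rewrite -[RHS]/(c * U' x - 2^-1 * (U' x * U x + U x * U' x) - (A' x * A x + A x * A' x)).
  by field.
apply: C1L2B; last exact: C1L2_mul CA CA' CA.
by apply: C1L2B; apply: C1L2Z => //; exact: C1L2_mul CU CU' CU.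
Qed.

(** The second row for (U', A', 0); the factor k / 2 times 2 keeps the coupling in the shape
    expected by [weak_mode]. *)
Lemma C1L2_A'' : C1L2 A'' (- Om *: A' - k *: (U * A') - (k / 2) *: (2 *: (A * U'))).
Proof.
have -> : - Om *: A' - k *: (U * A') - (k / 2) *: (2 *: (A * U')) =
    - Om *: A' - k *: (U' * A + U * A').
  apply/funext => x.
  rewrite -[LHS]/(- Om * A' x - k * (U x * A' x) - (k / 2) * (2 * (A x * U' x))).
  rewrite -[RHS]/(- Om * A' x - k * (U' x * A x + U x * A' x)).
  by field.
by apply: C1L2B; apply: C1L2Z => //; exact: C1L2_mul CU CU' CA.
Qed.

Lemma C1L2_inner_derive f f' : C1L2 f f' -> inner f f' = 0.
Proof. by move=> Cf; have := C1L2_ibp Cf Cf; rewrite (innerC f'); lra. Qed.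

Lemma hessianE w z1 z2 : hessian c k 1 Om U A (w, z1, z2) =
  (- D2 w + c *: w - U * w - 2 *: (A * z1),
   (2 / k) *: (- D2 z1 - Om *: z1 - k *: (U * z1)) - 2 *: (A * w),
   (2 / k) *: (- D2 z2 - Om *: z2 - k *: (U * z2))).
Proof.
rewrite /hessian; congr (_, _, _); apply/funext => x.
- rewrite -[RHS]/(- D2 w x + c * w x - U x * w x - 2 * (A x * z1 x)); ring.
- rewrite -[RHS]/((2 / k) * (- D2 z1 x - Om * z1 x - k * (U x * z1 x)) - 2 * (A x * w x)).
  by field; exact: lt0r_neq0.
- rewrite -[RHS]/((2 / k) * (- D2 z2 x - Om * z2 x - k * (U x * z2 x))).
  by field; exact: lt0r_neq0.
Qed.

(** The equation H v = lam v + (m U, n A, 0), solved for the second derivatives; m and n are the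
    multipliers of the two constraints. *)
Definition eigen_system lam m n w w' z1 z1' z2 z2' : Prop :=
  [/\ C1L2 w w' /\ C1L2 w' (c *: w - U * w - 2 *: (A * z1) - (lam *: w + m *: U)),
      C1L2 z1 z1' /\ C1L2 z1' (- Om *: z1 - k *: (U * z1) -
        (k / 2) *: (2 *: (A * w) + (lam *: z1 + n *: A))) &
      C1L2 z2 z2' /\ C1L2 z2' (- Om *: z2 - k *: (U * z2) - (k / 2) *: (lam *: z2))].

(** The residual H v - lam v is orthogonal to the constraint space, a product space, so each
    component can be tested alone: a multiple of U, a multiple of A, and zero. Continuity of the
    right-hand sides then gives classical derivatives. *)
Lemma chessian_eigen_system lam w z1 z2 :
  chessian c k 1 Om U A (w, z1, z2) (lam *: w, lam *: z1, lam *: z2) ->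
  [/\ inner U w = 0, inner A z1 = 0 &
      exists m n, eigen_system lam m n w (derive1 w) z1 (derive1 z1) z2 (derive1 z2)].
Proof.
move=> [Hw Hz1 Hz2 [Lw Lz1 Lz2 Uw Az1] [_]]; rewrite hessianE => orth.
rewrite /= in Hw Hz1 Hz2 Lw Lz1 Lz2 Uw Az1.
split => //.
have [LU LA] := (C1L2_Lsq CU, C1L2_Lsq CA).
have [Dw Dz1 Dz2] : [/\ Lsq (D2 w), Lsq (D2 z1) & Lsq (D2 z2)].
  by split; exact: H2_Lsq_D2.
set F1 := - D2 w + _ - _ - _ in orth; set F2 := _ - 2 *: (A * w) in orth.
set F3 := (2 / k) *: (- D2 z2 - _ - _) in orth.
have L1 : Lsq (F1 - lam *: w) by rewrite /F1; lsq.
have L2 : Lsq (F2 - lam *: z1) by rewrite /F2; lsq.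
have L3 : Lsq (F3 - lam *: z2) by rewrite /F3; lsq.
have i0 f : inner f 0 = 0 by rewrite innerC inner0l.
have [m m_] : exists m, {ae mu, forall x, (F1 - lam *: w) x = m * U x}.
  apply: Lsq_multiplier => // x Lx Ux.
  have := orth (x, 0, 0); rewrite /inner3 /= !i0 !addr0; apply.
  by split => //=; exact: Lsq0.
have [n n_] : exists n, {ae mu, forall x, (F2 - lam *: z1) x = n * A x}.
  apply: Lsq_multiplier => // x Lx Ax.
  have := orth (0, x, 0); rewrite /inner3 /= !i0 addr0 add0r; apply.
  by split => //=; exact: Lsq0.
have n3 : {ae mu, forall x, (F3 - lam *: z2) x = 0}.
  apply: inner_eq0_ae => //.
  have := orth (0, 0, F3 - lam *: z2); rewrite /inner3 /= !i0 !add0r; apply.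
  by split => //=; exact: Lsq0.
have [cU cA] := (C1L2_continuous CU, C1L2_continuous CA).
have [cw cz1 cz2] : [/\ continuous w, continuous z1 & continuous z2].
  by split; exact: H2_continuous.
have cM f g : continuous f -> continuous g -> continuous (f * g).
  by move=> cf cg x; apply: cvgM; [exact: cf|exact: cg].
have cZ a f : continuous f -> continuous (a *: f).
  by move=> cf x; apply: cvgZr; exact: cf.
have cD f g : continuous f -> continuous g -> continuous (f + g).
  by move=> cf cg x; apply: cvgD; [exact: cf|exact: cg].
have cB f g : continuous f -> continuous g -> continuous (f - g).
  by move=> cf cg x; apply: cvgB; [exact: cf|exact: cg].
have kn0 := lt0r_neq0 k0.
exists m, n; split; apply: D2_continuous_rhs => //.
- by auto 20.
- apply: ae_sub m_ => x E.
  have {}E : - D2 w x + c * w x - U x * w x - 2 * (A x * z1 x) - lam * w x = m * U x.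
    exact: E.
  rewrite -[LHS]/(D2 w x - (c * w x - U x * w x - 2 * (A x * z1 x) -
    (lam * w x + m * U x))).
  by rewrite -E; ring.
- by auto 20.
- apply: ae_sub n_ => x E.
  have {}E : (2 / k) * (- D2 z1 x - Om * z1 x - k * (U x * z1 x)) - 2 * (A x * w x)
      - lam * z1 x = n * A x by exact: E.
  rewrite -[LHS]/(D2 z1 x - (- Om * z1 x - k * (U x * z1 x) -
    (k / 2) * (2 * (A x * w x) + (lam * z1 x + n * A x)))).
  by rewrite -E; field.
- by auto 20.
- apply: ae_sub n3 => x E.
  have {}E : (2 / k) * (- D2 z2 x - Om * z2 x - k * (U x * z2 x)) - lam * z2 x = 0.
    exact: E.
  rewrite -[LHS]/(D2 z2 x - (- Om * z2 x - k * (U x * z2 x) - (k / 2) * (lam * z2 x))).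
  transitivity (- (k / 2) * ((2 / k) * (- D2 z2 x - Om * z2 x - k * (U x * z2 x)) - lam * z2 x)).
    by field.
  by rewrite E mulr0.
Qed.

(** Symmetry of the Hessian: the system is tested with the kernel vectors (U', A', 0) and (0, 0, A).
    The multipliers disappear because <U, U'> = <A, A'> = 0. *)
Lemma eigen_system_orth lam m n w w' z1 z1' z2 z2' :
  eigen_system lam m n w w' z1 z1' z2 z2' ->
  lam * (inner w U' + inner z1 A') = 0 /\ lam * inner z2 A = 0.
Proof.
move=> [[Cw Cw'] [Cz1 Cz1'] [Cz2 Cz2']].
have [LU LU'] := (C1L2_Lsq CU, C1L2_Lsq' CU).
have [LA LA'] := (C1L2_Lsq CA, C1L2_Lsq' CA).
have [Lw Lz1 Lz2] : [/\ Lsq w, Lsq z1 & Lsq z2].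
  by split; [exact: C1L2_Lsq Cw|exact: C1L2_Lsq Cz1|exact: C1L2_Lsq Cz2].
have UU' := C1L2_inner_derive CU; have AA' := C1L2_inner_derive CA.
split.
  have := weak_wave Cw Lz1 (LsqD (LsqZ lam Lw) (LsqZ m LU)) CU' Cw'.
  have L0 := @Lsq0 R.
  have CU''0 : C1L2 U'' (c *: U' - U * U' - 2 *: (A * A') - 0).
    by rewrite subr0; exact: C1L2_U''.
  have := weak_wave CU' LA' L0 Cw CU''0.
  have LA2 : Lsq (2 *: (A * U')) by lsq.
  have LA3 : Lsq (2 *: (A * w) + (lam *: z1 + n *: A)) by lsq.
  have := weak_mode CA' LA2 Cz1 C1L2_A''.
  have := weak_mode Cz1 LA3 CA' Cz1'.
  rewrite [inner (2 *: (A * w) + _) _]innerDl; [|lsq|lsq|lsq].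
  rewrite [inner (lam *: z1 + _) _]innerDl; [|lsq|lsq|lsq].
  rewrite [inner (lam *: w + _) _]innerDl; [|lsq|lsq|lsq].
  rewrite ![inner (_ *: _) A']innerZl; [|lsq..].
  rewrite ![inner (_ *: (A * U')) _]innerZl; [|lsq..].
  rewrite ![inner (_ *: w) _]innerZl ?[inner (_ *: U) _]innerZl; [|lsq..].
  rewrite inner0l UU' AA'.
  rewrite (innerC A'' z1') (innerC A' z1) (inner_mull U A' z1) (innerC A' (U * z1)).
  rewrite (innerC U'' w') (innerC U' w) (inner_mull U U' w) (innerC U' (U * w)).
  rewrite (inner_mull A A' w) (innerC A' (A * w)) (inner_mull A U' z1) (innerC U' (A * z1)).
  move: (2 / k * _) => q; lra.
have LA0 : Lsq (lam *: z2) by lsq.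
have := weak_mode Cz2 LA0 CA Cz2'.
have CA0 : C1L2 A' (- Om *: A - k *: (U * A) - (k / 2) *: 0).
  by rewrite scaler0 subr0.
have := weak_mode CA (@Lsq0 R) Cz2 CA0.
rewrite inner0l innerZl//.
rewrite (innerC A' z2') (innerC A z2) (inner_mull U A z2) (innerC A (U * z2)).
by move=> ->.
Qed.

End ConstrainedHessian.

(** * Vectors with nonpositive eigenvalue and the symmetry modes *)

Section CriticalVectors.
Context {R : realType}.
Local Notation mu := (@lebesgue_measure R).
Variables th k Om : R.
Local Notation c := (4 * th ^+ 2).
Local Notation T := (tanh_sc th).
Local Notation S := (sech_pow th).
Hypothesis k0 : 0 < k.
Variables U U' A A' : R -> R.
Local Notation U'' := (c *: U - 2^-1 *: (U * U) - A * A).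
Local Notation A'' := (- Om *: A - k *: (U * A)).
Hypotheses (CU : C1L2 U U') (CU' : C1L2 U' U'').
Hypotheses (CA : C1L2 A A') (CA' : C1L2 A' A'').
Implicit Types (f g h w z u y : R -> R) (a b lam : R).

(** Subtracting kernel vectors leaves the right-hand side lam v + (m U, n A, 0) unchanged. Tested
    with the remainder, which satisfies the constraints, it loses its multiplier terms. *)
Lemma eigen_system_reduce lam m n w w' z1 z1' z2 z2' a b :
  eigen_system c k Om U A lam m n w w' z1 z1' z2 z2' ->
  inner U w = 0 -> inner A z1 = 0 -> inner A (z2 - b *: A) = 0 ->
  [/\ C1L2 (w - a *: U') (w' - a *: U'') /\ C1L2 (z1 - a *: A') (z1' - a *: A''),
      C1L2 (z2 - b *: A) (z2' - b *: A'),
      inner U (w - a *: U') = 0, inner A (z1 - a *: A') = 0 &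
      hessian_form th k Om U A (w - a *: U') (w' - a *: U'') (z1 - a *: A')
        (z1' - a *: A'') (z2 - b *: A) (z2' - b *: A') =
      lam * (inner w (w - a *: U') + inner z1 (z1 - a *: A') + inner z2 (z2 - b *: A))].
Proof.
move=> [[Cw Cw'] [Cz1 Cz1'] [Cz2 Cz2']] Uw Az1 Az2.
have [LU LU'] := (C1L2_Lsq CU, C1L2_Lsq' CU).
have [LA LA'] := (C1L2_Lsq CA, C1L2_Lsq' CA).
have LsqU f : Lsq f -> Lsq (U * f) by exact: C1L2_LsqM CU.
have LsqA f : Lsq f -> Lsq (A * f) by exact: C1L2_LsqM CA.
have [Lw Lz1 Lz2] : [/\ Lsq w, Lsq z1 & Lsq z2].
  by split; [exact: C1L2_Lsq Cw|exact: C1L2_Lsq Cz1|exact: C1L2_Lsq Cz2].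
have UU' := C1L2_inner_derive CU; have AA' := C1L2_inner_derive CA.
have Crw := C1L2B Cw (C1L2Z a CU').
have Crz1 := C1L2B Cz1 (C1L2Z a CA').
have Crz2 := C1L2B Cz2 (C1L2Z b CA).
have Urw : inner U (w - a *: U') = 0 by inner_expand; rewrite Uw UU'; ring.
have Arz1 : inner A (z1 - a *: A') = 0 by inner_expand; rewrite Az1 AA'; ring.
split => //.
have Crw' := C1L2B Cw' (C1L2Z a (C1L2_U'' CU CU' CA CA')).
have Crz1' := C1L2B Cz1' (C1L2Z a (C1L2_A'' k Om CU CU' CA)).
have Crz2' := C1L2B Cz2' (C1L2Z b CA').
have Ew : c *: w - U * w - 2 *: (A * z1) - (lam *: w + m *: U) -
    a *: (c *: U' - U * U' - 2 *: (A * A')) =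
    c *: (w - a *: U') - U * (w - a *: U') - 2 *: (A * (z1 - a *: A')) - (lam *: w + m *: U).
  apply/funext => x.
  rewrite -[LHS]/(c * w x - U x * w x - 2 * (A x * z1 x) - (lam * w x + m * U x) -
    a * (c * U' x - U x * U' x - 2 * (A x * A' x))).
  rewrite -[RHS]/(c * (w x - a * U' x) - U x * (w x - a * U' x) -
    2 * (A x * (z1 x - a * A' x)) - (lam * w x + m * U x)).
  by ring.
have Ez1 : - Om *: z1 - k *: (U * z1) - (k / 2) *: (2 *: (A * w) + (lam *: z1 + n *: A)) -
    a *: (- Om *: A' - k *: (U * A') - (k / 2) *: (2 *: (A * U'))) =
    - Om *: (z1 - a *: A') - k *: (U * (z1 - a *: A')) -
    (k / 2) *: (2 *: (A * (w - a *: U')) + (lam *: z1 + n *: A)).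
  apply/funext => x.
  rewrite -[LHS]/(- Om * z1 x - k * (U x * z1 x) -
    (k / 2) * (2 * (A x * w x) + (lam * z1 x + n * A x)) -
    a * (- Om * A' x - k * (U x * A' x) - (k / 2) * (2 * (A x * U' x)))).
  rewrite -[RHS]/(- Om * (z1 x - a * A' x) - k * (U x * (z1 x - a * A' x)) -
    (k / 2) * (2 * (A x * (w x - a * U' x)) + (lam * z1 x + n * A x))).
  by ring.
have Ez2 : - Om *: z2 - k *: (U * z2) - (k / 2) *: (lam *: z2) -
    b *: (- Om *: A - k *: (U * A)) =
    - Om *: (z2 - b *: A) - k *: (U * (z2 - b *: A)) - (k / 2) *: (lam *: z2).
  apply/funext => x.
  rewrite -[LHS]/(- Om * z2 x - k * (U x * z2 x) - (k / 2) * (lam * z2 x) -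
    b * (- Om * A x - k * (U x * A x))).
  rewrite -[RHS]/(- Om * (z2 x - b * A x) - k * (U x * (z2 x - b * A x)) -
    (k / 2) * (lam * z2 x)).
  by ring.
rewrite {}Ew in Crw'; rewrite {}Ez1 in Crz1'; rewrite {}Ez2 in Crz2'.
have Lrw := C1L2_Lsq Crw; have Lrz1 := C1L2_Lsq Crz1; have Lrz2 := C1L2_Lsq Crz2.
move: Lrw Lrz1 Lrz2 Crw Crz1 Crz2 Crw' Crz1' Crz2' Urw Arz1 Az2.
move: (w - a *: U') (z1 - a *: A') (z2 - b *: A) (w' - a *: U'') (z1' - a *: A'') (z2' - b *: A').
move=> rw rz1 rz2 rw' rz1' rz2' Lrw Lrz1 Lrz2 Crw Crz1 Crz2 Crw' Crz1' Crz2' Urw Arz1 Arz2.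
have G1 : Lsq (lam *: w + m *: U) by lsq.
have G2 : Lsq (2 *: (A * rw) + (lam *: z1 + n *: A)) by lsq.
have G3 : Lsq (lam *: z2) by lsq.
have := weak_wave CU CA Crw Lrz1 G1 Crw Crw'.
have := weak_mode k0 CU Crz1 G2 Crz1 Crz1'.
have := weak_mode k0 CU Crz2 G3 Crz2 Crz2'.
rewrite /hessian_form => -> ->; inner_expand.
rewrite Urw Arz1 (inner_mull A rz1) (innerC rz1 (A * rw)); lra.
Qed.

(** By [eigen_system_orth] the form at the remainder equals lam |v|^2, which is nonpositive;
    coercivity annihilates the remainder, and then the form itself. *)
Lemma critical_vector lam m n w w' z1 z1' z2 z2' :
  inner (T * S 2) U' != 0 ->
  (forall w w' z1 z1' z2 z2' : R -> R, C1L2 w w' -> C1L2 z1 z1' -> C1L2 z2 z2' ->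
    inner (T * S 2) w = 0 -> inner U w = 0 -> inner A z1 = 0 -> inner A z2 = 0 ->
    hessian_form th k Om U A w w' z1 z1' z2 z2' <= 0 ->
    [/\ inner w w = 0, inner z1 z1 = 0 & inner z2 z2 = 0]) ->
  0 < th -> 0 < inner A A -> lam <= 0 ->
  eigen_system c k Om U A lam m n w w' z1 z1' z2 z2' ->
  inner U w = 0 -> inner A z1 = 0 ->
  exists a b, [/\ w = a *: U', z1 = a *: A', z2 = b *: A &
    lam * (inner w w + inner z1 z1 + inner z2 z2) = 0].
Proof.
move=> TSU' coer th0 AA0 lam0 es Uw Az1.
have [orth1 orth2] := eigen_system_orth k0 CU CU' CA CA' es.
have LA := C1L2_Lsq CA; have [LU' LA'] := (C1L2_Lsq' CU, C1L2_Lsq' CA).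
have [Lw Lz1 Lz2] : [/\ Lsq w, Lsq z1 & Lsq z2].
  case: (es) => -[Cw _] [Cz1 _] [Cz2 _].
  by split; [exact: C1L2_Lsq Cw|exact: C1L2_Lsq Cz1|exact: C1L2_Lsq Cz2].
have LTS : Lsq (T * S 2) by apply/(Lsq_tanh th)/Lsq_sech_pow.
(* The translational component is fixed by pairing with tanh sech^2 rather than with U', to match
   the hypothesis of coercivity. *)
pose a := inner (T * S 2) w / inner (T * S 2) U'.
pose b := inner A z2 / inner A A.
have TSr : inner (T * S 2) (w - a *: U') = 0 by inner_expand; rewrite /a divfK// subrr.
have Ar : inner A (z2 - b *: A) = 0.
  by inner_expand; rewrite /b divfK ?subrr// lt0r_neq0.
have [[Cr1 Cr2] Cr3 Ur1 Ar2 form] := eigen_system_reduce a es Uw Az1 Ar.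
have formE : hessian_form th k Om U A (w - a *: U') (w' - a *: U'') (z1 - a *: A')
    (z1' - a *: A'') (z2 - b *: A) (z2' - b *: A')
    = lam * (inner w w + inner z1 z1 + inner z2 z2).
  rewrite form; inner_expand.
  transitivity (lam * (inner w w + inner z1 z1 + inner z2 z2)
    - a * (lam * (inner w U' + inner z1 A')) - b * (lam * inner z2 A)); first by ring.
  by rewrite orth1 orth2; ring.
have q0 : 0 <= inner w w + inner z1 z1 + inner z2 z2.
  by rewrite !addr_ge0 ?inner_ge0.
have [|r1 r2 r3] := coer _ _ _ _ _ _ Cr1 Cr2 Cr3 TSr Ur1 Ar2 Ar.
  by rewrite formE mulr_le0_ge0.
have Lr := (C1L2_Lsq Cr1, C1L2_Lsq Cr2, C1L2_Lsq Cr3).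
have e1 := inner_eq0 (C1L2_continuous Cr1) Lr.1.1 r1.
have e2 := inner_eq0 (C1L2_continuous Cr2) Lr.1.2 r2.
have e3 := inner_eq0 (C1L2_continuous Cr3) Lr.2 r3.
exists a, b; split; [exact: subr0_eq|exact: subr0_eq|exact: subr0_eq|].
have i0 f : inner f 0 = 0 by rewrite innerC inner0l.
by rewrite -formE form e1 e2 e3 !i0 !addr0 mulr0.
Qed.

(** The full Hessian already annihilates these vectors, though only almost everywhere, since [D2] is
    fixed up to a null set; the constraints hold because <U, U'> = <A, A'> = 0. *)
Lemma symmetry_in_kernel a b :
  chessian_ker c k 1 Om U A (a *: U', a *: A', b *: A).
Proof.
have [LU LU'] := (C1L2_Lsq CU, C1L2_Lsq' CU).
have [LA LA'] := (C1L2_Lsq CA, C1L2_Lsq' CA).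
have [CU'' CA''] := (C1L2_U'' CU CU' CA CA', C1L2_A'' k Om CU CU' CA).
have LsqU f : Lsq f -> Lsq (U * f) by exact: C1L2_LsqM CU.
have LsqA f : Lsq f -> Lsq (A * f) by exact: C1L2_LsqM CA.
have [H1 _ D1] := C1L2_H2 (C1L2Z a CU') (C1L2Z a CU'').
have [H2_ _ D2_] := C1L2_H2 (C1L2Z a CA') (C1L2Z a CA'').
have [H3 _ D3] := C1L2_H2 (C1L2Z b CA) (C1L2Z b CA').
have i0 f : inner f 0 = 0 by rewrite innerC inner0l.
split => //=.
  split => /=; [lsq|lsq|lsq| |]; rewrite innerZr//.
    by rewrite (C1L2_inner_derive CU) mulr0.
  by rewrite (C1L2_inner_derive CA) mulr0.
split.
  by split => /=; rewrite ?i0//; exact: Lsq0.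
move=> [[x1 x2] x3] [/= Lx1 Lx2 Lx3 _ _].
have hE := hessianE c Om k0 U A (a *: U') (a *: A') (b *: A).
rewrite -[X in inner3 (X - _)]/(hessian c k 1 Om U A (a *: U', a *: A', b *: A)) hE.
have ae0 f g : Lsq f -> Lsq g -> {ae mu, forall x, f x = 0} -> inner (f - cst 0) g = 0.
  move=> Lf Lg f0; have -> : f - cst 0 = f by exact: subr0.
  rewrite -(inner0l g).
  exact: (inner_ae (Lsq_measurable Lf) (Lsq_measurable (@Lsq0 R)) (Lsq_measurable Lg)).
have kn0 := lt0r_neq0 k0.
have [LD1 LD2 LD3] := And3 (H2_Lsq_D2 H1) (H2_Lsq_D2 H2_) (H2_Lsq_D2 H3).
rewrite /inner3 /= !ae0 ?addr0//; try lsq.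
- apply: ae_sub D3 => x E.
  rewrite -[LHS]/((2 / k) * (- D2 (b *: A) x - Om * (b * A x) - k * (U x * (b * A x)))).
  rewrite E -[(b *: A'') x]/(b * (- Om * A x - k * (U x * A x))); ring.
- apply: ae_sub D2_ => x E.
  rewrite -[LHS]/((2 / k) * (- D2 (a *: A') x - Om * (a * A' x) - k * (U x * (a * A' x)))
    - 2 * (A x * (a * U' x))).
  rewrite E -[(a *: _) x]/(a * (- Om * A' x - k * (U x * A' x) - (k / 2) * (2 * (A x * U' x)))).
  by field.
- apply: ae_sub D1 => x E.
  rewrite -[LHS]/(- D2 (a *: U') x + c * (a * U' x) - U x * (a * U' x) - 2 * (A x * (a * A' x))).
  rewrite E -[(a *: _) x]/(a * (c * U' x - U x * U' x - 2 * (A x * A' x))); ring.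
Qed.

End CriticalVectors.

Theorem proposition4 (R : realType) (c k : R) (hc : 0 < c) (hk : 0 < k)
  (hq : bif_coef c k < 0 \/ 0 < bif_coef c k) :
  forall C : R, exists2 delta : R, 0 < delta &
    forall (Om : R) (U A : R -> R),
      Om != Omega_c c k -> `|Om - Omega_c c k| < delta ->
      branch_profile c k 1 C Om U A ->
      (forall lam : R, lam < 0 -> ~ chessian_eigenvalue c k 1 Om U A lam) /\
      chessian_ker c k 1 Om U A = symmetry_span U A.
Proof.
move=> C; set th := Num.sqrt c / 2.
have th0 : 0 < th by rewrite divr_gt0// sqrtr_gt0.
have [e e0 coer] := hessian_form_coercive th0 hk (p_exp_gt0 hk) (p_expE hk).
have [delta d0 near_delta] := profile_near C hc hk e0.
exists delta => // Om U A _ Omd bp.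
have ns := near_delta _ _ _ Omd bp.
have [TSU' {}coer] := coer _ _ _ _ _ ns.
have [_ _ _ _ [AA0 _]] := ns.
have [[CU] ] := profile_C1L2 bp.
rewrite -{1}(sqrt_half_sqr hc) -/th => CU' [CA CA'].
have cE : c = 4 * th ^+ 2 by rewrite /th sqrt_half_sqr.
(* One statement for both conclusions: lam < 0 excludes eigenvalues, lam = 0 gives the kernel. *)
have crit lam v : lam <= 0 ->
    chessian c k 1 Om U A v (lam *: v.1.1, lam *: v.1.2, lam *: v.2) ->
    symmetry_span U A v /\ lam * inner3 v v = 0.
  case: v => [[w z1] z2] lam0; rewrite cE.
  move=> /(chessian_eigen_system hk CU CA)[Uw Az1 [m [n es]]].
  have [a [b [wE z1E z2E lam_v]]] :=
    critical_vector hk CU CU' CA CA' TSU' coer th0 AA0 lam0 es Uw Az1.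
  by split; [exists a, b; rewrite wE z1E z2E|exact: lam_v].
split=> [lam lam0 [v v0 hv]|].
  have [_ /eqP] := crit lam v (ltW lam0) hv.
  rewrite mulf_eq0 (lt_eqF lam0) /= /inner3 => /eqP v00; apply: v0.
  have [j1 j2 j3] : [/\ inner v.1.1 v.1.1 = 0, inner v.1.2 v.1.2 = 0 & inner v.2 v.2 = 0].
    move/eqP: v00; rewrite !paddr_eq0 ?addr_ge0 ?inner_ge0//.
    by move=> /andP[/andP[/eqP ? /eqP ?] /eqP ?].
  case: hv => [H1v H2v H3v _ _].
  (* An eigenvector is nonzero as a triple of functions, so zero norm must give zero everywhere;
     continuity of the H^2 representatives provides this. *)
  have zero (f : R -> R) : H2 f -> inner f f = 0 -> f = cst 0.
    by move=> Hf; apply: inner_eq0; [exact: H2_continuous|exact: H2_Lsq].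
  rewrite [v]surjective_pairing [v.1]surjective_pairing.
  by rewrite (zero _ H1v j1) (zero _ H2v j2) (zero _ H3v j3).
apply/seteqP; split=> v.
  move=> hv; have [|//] := crit 0 v (lexx 0).
  by rewrite !scale0r.
by move=> [a [b ->]]; rewrite cE; exact: symmetry_in_kernel.
Qed.
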